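(* Assume the setting and standing assumptions given in the context, let $T\ge 0$ be the number from assumption (ii), and let $t_1>T$. Let the sequence $\{\varphi_j\}_{j\ge1}$ of eigenvectors of $A$ be strongly minimal in $X$. Consider the sequence of functions $$\{e^{-\lambda_jt}b_j,\ t\in[0,t_1-T]\},\quad j=1,2,\dots,\qquad(\star)$$ in $L_2[0,t_1-T]$, where $b_j=(b,\psi_j)$. (Necessity) If the equation $\dot x(t)=Ax(t)+bu(t)$, $x(0)=x_0$, is exact null-controllable on $[0,t_1]$ by controls vanishing after time moment $t_1-T$, then the sequence $(\star)$ is minimal. (Sufficiency) If there is $\beta\in\mathbb R$ with $\operatorname{Re}\lambda_j\ge\beta$ for all $j$, and the sequence $(\star)$ is strongly minimal, then the equation is exact null-controllable on $[0,t_1]$ by controls vanishing after time moment $t_1-T$.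
   Context: Setting: $X$ is a separable complex Hilbert space; $A$ is the infinitesimal generator of a strongly continuous ($C_0$) semigroup $S(t)$ on $X$. $W\subset X\subset V$ are Hilbert spaces with continuous dense injections, where $W=D(A^* )$ with the graph norm and $V=W^*$ is its dual with respect to the pivot space $X$. For each $t\ge 0$, $S(t)$ extends uniquely to a bounded operator $\mathcal S(t)$ on $V$, and $\mathcal S(t)$ is a $C_0$-semigroup on $V$ whose generator extends $A$ and has domain $X$. The control space is $U=\mathbb C$ (one input), and the (possibly unbounded) input operator is $u\mapsto bu$ with a fixed $b\in V$. $(\cdot,\cdot)$ denotes the inner product of $X$ and also its extension to the duality pairing of $V$ with $W$. The mild solution of $\dot x(t)=Ax(t)+bu(t)$, $x(0)=x_0\in X$, is $x(t,x_0,u(\cdot))=S(t)x_0+\int_0^t\mathcal S(t-\tau)bu(\tau)\,d\tau$ (Bochner integral in $V$). It is assumed that $\int_0^t\mathcal S(t-\tau)bu(\tau)\,d\tau\in X$ for all $u(\cdot)\in L_2^{\rm loc}[0,+\infty)$ and $t\ge0$. Standing assumptions on $A$: (i) $A$ has purely point spectrum $\sigma$ with no finite limit points, and all eigenvalues have (algebraic) multiplicity $1$. (ii) There exists $T\ge0$ such that every mild solution of $\dot x(t)=Ax(t)$ expands in a series of eigenvectors of $A$ which converges uniformly in $t\in[T_1,T_2]$ for any $T<T_1<T_2$. Notation: $\lambda_j$, $j=1,2,\dots$, are the eigenvalues of $A$, enumerated in order of non-decreasing absolute value; $\varphi_j$ and $\psi_j$ are corresponding eigenvectors of $A$ and $A^*$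 ($A\varphi_j=\lambda_j\varphi_j$, $A^*\psi_j=\overline{\lambda_j}\psi_j$), normalized so that $(\varphi_k,\psi_j)=\delta_{kj}$. The number $b_j=(b,\psi_j)$ is well defined since $\psi_j\in W$, $b\in V$. $L_2[0,s]$ is the space of complex-valued square integrable functions. Definition: the equation is exact null-controllable on $[0,t_1]$ by controls vanishing after time moment $t_2$ if for each $x_0\in X$ there is a control $u(\cdot)\in L_2[0,t_2]$, with $u(t)=0$ a.e. on $[t_2,+\infty)$, such that $x(t_1,x_0,u(\cdot))=0$. Definitions for a sequence $\{x_j\}_{j\ge1}$ in a Hilbert space: it is minimal if for each $j$, $x_j\notin\overline{\mathrm{span}}\{x_k: k\ne j\}$. It is strongly minimal if $\lim_{n\to\infty}\gamma_n^{\min}>0$, where $\gamma_n^{\min}$ is the minimal eigenvalue of the Gram matrix $\{(x_i,x_j)\}_{i,j=1}^n$ (a non-increasing nonnegative sequence). *)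

(* Defs.v *)
From HB Require Import structures.
From mathcomp Require Import all_boot all_order all_algebra.
From mathcomp Require Import sesquilinear.
From mathcomp Require Import complex.
From mathcomp Require Import all_classical all_reals all_analysis.

Set Implicit Arguments.
Unset Strict Implicit.
Unset Printing Implicit Defensive.

Import Order.TTheory GRing.Theory Num.Theory.
Import numFieldNormedType.Exports.

Local Open Scope classical_set_scope.
Local Open Scope complex_scope.
Local Open Scope ring_scope.

Section Scalars.
Variable R : realType.

Definition cexp (z : R[i]) : R[i] :=
  (expR (complex.Re z))%:C * (cos (complex.Im z) +i* sin (complex.Im z)).

(* The norm of a normed module over R[i] takes values in R[i]; [rnorm] is the
   same number seen in R. *)
Definition rnorm (E : normedModType R[i]) (x : E) : R := complex.Re `|x|.

Definition cintegral (D : set R) (f : R -> R[i]) : R[i] :=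
  (\int[@lebesgue_measure R]_(t in D) complex.Re (f t)) +i*
  (\int[@lebesgue_measure R]_(t in D) complex.Im (f t)).

Definition L2 (D : set R) (u : R -> R[i]) : Prop :=
  [/\ measurable_fun D (fun t => complex.Re (u t)),
      measurable_fun D (fun t => complex.Im (u t)) &
      (\int[@lebesgue_measure R]_(t in D) ((complex.Re `|u t|) ^+ 2)%:E
         < +oo)%E].

Definition L2loc (u : R -> R[i]) : Prop :=
  forall t : R, 0 <= t -> L2 `[0, t] u.

(* Inner product of L_2[0, s]; functions are not quotiented by equality almost
   everywhere, so it is only positive semi-definite. *)
Definition L2dot (s : R) (f g : R -> R[i]^o) : R[i] :=
  cintegral `[0, s] (fun t => (f t : R[i]) * Num.conj (g t : R[i])).

End Scalars.

Section Hilbert.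
Variable R : realType.

(* A Hilbert space is a complete normed module over R[i] whose norm comes from
   an inner product; [{dot E for Num.conj}] is linear in its first argument. *)
Definition inner_product_norm (E : completeNormedModType R[i])
    (dot : {dot E for Num.conj}) : Prop :=
  forall x : E, `|x| ^+ 2 = dot x x.

Definition separable_space (E : topologicalType) : Prop :=
  exists D : set E, countable D /\ dense D.

End Hilbert.

(* Sequences are indexed from 0. The form [ip] is the inner product of the
   ambient space, or a semi-definite one inducing it on classes (as [L2dot]),
   whence the closure with respect to the seminorm sqrt (ip z z). *)
Section Sequences.
Variables (R : realType) (E : lmodType R[i]) (ip : E -> E -> R[i]).

Definition span_except (x : nat -> E) (j : nat) : set E :=
  [set y | exists (n : nat) (c : nat -> R[i]),
     y = \sum_(k < n | (k : nat) != j) c k *: x k].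

Definition ip_closure (A : set E) : set E :=
  [set z | forall e : R, 0 < e ->
     exists2 y, A y & Num.sqrt (complex.Re (ip (z - y) (z - y))) < e].

Definition minimal_seq (x : nat -> E) : Prop :=
  forall j, ~ ip_closure (span_except x j) (x j).

Definition gram (x : nat -> E) (n : nat) : 'M[R[i]]_n :=
  \matrix_(i < n, j < n) ip (x i) (x j).

Definition is_min_eigenvalue (n : nat) (G : 'M[R[i]]_n) (g : R) : Prop :=
  eigenvalue G g%:C /\ forall a : R[i], eigenvalue G a -> g%:C <= a.

(* The empty Gram matrix has no eigenvalue: [gam n] belongs to the first n + 1
   vectors. *)
Definition strongly_minimal_seq (x : nat -> E) : Prop :=
  exists (gam : nat -> R) (l : R),
    [/\ forall n, is_min_eigenvalue (gram x n.+1) (gam n),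
        gam n @[n --> \oo] --> l &
        0 < l].

End Sequences.

(* Integral over D with respect to Lebesgue measure of a function with values
   in a normed space. *)
Section Bochner.
Variables (R : realType) (E : normedModType R[i]).
Local Notation mu := (@lebesgue_measure R).

Definition is_simple (D : set R) (s : {fimfun R >-> E}) : Prop :=
  forall v : E, measurable (D `&` s @^-1` [set v]) /\
    (v != 0 -> (mu (D `&` s @^-1` [set v]) < +oo)%E).

Definition simple_integral (D : set R) (s : {fimfun R >-> E}) : E :=
  \sum_(v \in range s) (fine (mu (D `&` s @^-1` [set v])))%:C *: v.

Definition is_Bochner_integral (D : set R) (f : R -> E) (v : E) : Prop :=
  exists s : nat -> {fimfun R >-> E},
    [/\ forall n, is_simple D (s n),
        {ae mu, forall t, D t -> s n t @[n --> \oo] --> f t},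
        (\int[mu]_(t in D) (rnorm (f t - s n t))%:E)%E @[n --> \oo] --> 0%E &
        simple_integral D (s n) @[n --> \oo] --> v].

End Bochner.

(* Unbounded operators are identified with their graphs. *)
Section Operators.
Variables (R : realType) (E : completeNormedModType R[i]).
Implicit Types (S : R -> {linear E -> E}) (A : set (E * E)).

Definition op_dom A : set E := [set x | exists y, A (x, y)].

(* The values of S at negative times are irrelevant. *)
Definition C0_semigroup S : Prop :=
  [/\ forall t, 0 <= t -> continuous (S t),
      forall x, S 0 x = x,
      forall s t x, 0 <= s -> 0 <= t -> S (s + t) x = S s (S t x) &
      forall x, S h x @[h --> 0^'+] --> x].

Definition generator S : set (E * E) :=
  [set p | (h^-1)%:C *: (S h p.1 - p.1) @[h --> 0^'+] --> p.2].

Definition adjoint (dot : E -> E -> R[i]) A : set (E * E) :=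
  [set q | forall p, A p -> dot p.2 q.1 = dot p.1 q.2].

Definition point_spectrum A : set R[i] :=
  [set z | exists2 x, x != 0 & A (x, z *: x)].

Definition resolvent_set A : set R[i] :=
  [set z | (forall y, exists! x, A (x, z *: x - y)) /\
     exists M : R, forall x y, A (x, z *: x - y) -> rnorm x <= M * rnorm y].

Definition spectrum A : set R[i] := ~` resolvent_set A.

(* (A - z)^n x = 0, with x in the domain of A^n. *)
Fixpoint root_vector A (z : R[i]) (n : nat) (x : E) : Prop :=
  if n is m.+1 then exists2 y, A (x, z *: x + y) & root_vector A z m y
  else x = 0.

(* The root subspace of z is one-dimensional. *)
Definition algebraically_simple A (z : R[i]) : Prop :=
  exists2 e : E, e != 0 &
    [set x | exists n, root_vector A z n x] = [set a *: e | a in [set: R[i]]].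

Definition simple_discrete_spectrum A : Prop :=
  [/\ spectrum A = point_spectrum A,
      limit_point (spectrum A : set R[i]^o) = set0 &
      forall z, spectrum A z -> algebraically_simple A z].

Definition eigenvector_expansion S (phi : nat -> E) (T : R) : Prop :=
  forall x0 : E, exists c : nat -> R -> R[i],
    forall T1 T2 : R, T < T1 -> T1 < T2 ->
      {uniform `[T1, T2],
        (fun (n : nat) (t : R) => \sum_(j < n) c j t *: phi j) @ \oo -->
        (fun t : R => S t x0)}.

End Operators.

Section Rigging.
Variables (R : realType) (X V : completeNormedModType R[i]).
Variables (dot : {dot X for Num.conj}) (iota : {linear X -> V}).
Variable duality : V -> X -> R[i].

Definition graph_norm (p : X * X) : R :=
  Num.sqrt (rnorm p.1 ^+ 2 + rnorm p.2 ^+ 2).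

(* W is the domain of the operator with graph B, under the graph norm. V is its
   antidual: v is identified with the functional [duality v], antilinear and
   bounded on W, x in X with (x, .), and the norm of V is the dual norm. The
   values of [duality v] off W are irrelevant. *)
Definition antidual_of_domain (B : set (X * X)) : Prop :=
  [/\ forall w, op_dom B w -> forall a v1 v2,
        duality (a *: v1 + v2) w = a * duality v1 w + duality v2 w,
      forall v a w1 w2, op_dom B w1 -> op_dom B w2 ->
        duality v (a *: w1 + w2) = Num.conj a * duality v w1 + duality v w2,
      forall v,
        (forall p, B p -> complex.Re `|duality v p.1| <= rnorm v * graph_norm p) /\
        (forall M : R, 0 <= M ->
           (forall p, B p -> complex.Re `|duality v p.1| <= M * graph_norm p) ->
           rnorm v <= M),
      forall F : X -> R[i],
        (forall a w1 w2, op_dom B w1 -> op_dom B w2 ->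
           F (a *: w1 + w2) = Num.conj a * F w1 + F w2) ->
        (exists M : R, forall p, B p ->
           complex.Re `|F p.1| <= M * graph_norm p) ->
        exists v, forall w, op_dom B w -> F w = duality v w &
      forall x w, op_dom B w -> duality (iota x) w = dot x w].

(* Continuity of the injection of W into X is clear from the graph norm. *)
Definition dense_injections (B : set (X * X)) : Prop :=
  [/\ dense (op_dom B), injective iota, continuous iota & dense (range iota)].

Variables (S : R -> {linear X -> X}) (SV : R -> {linear V -> V}).

Definition semigroup_extension : Prop :=
  [/\ C0_semigroup SV,
      forall t x, 0 <= t -> SV t (iota x) = iota (S t x),
      forall p, generator S p -> generator SV (iota p.1, iota p.2) &
      op_dom (generator SV) = range iota].

Variable b : V.

Definition input_term (t : R) (u : R -> R[i]) (v : V) : Prop :=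
  is_Bochner_integral `[0, t] (fun tau : R => u tau *: SV (t - tau) b) v.

Definition admissible_input : Prop :=
  forall u, L2loc u -> forall t, 0 <= t -> exists x : X, input_term t u (iota x).

(* x is the value at time t of the mild solution with initial state x0. *)
Definition mild_solution (t : R) (x0 : X) (u : R -> R[i]) (x : X) : Prop :=
  exists2 v : V, input_term t u v & iota x = iota (S t x0) + v.

Definition exact_null_controllable (t1 t2 : R) : Prop :=
  forall x0 : X, exists u : R -> R[i],
    [/\ L2 `[0, t2] u,
        {ae @lebesgue_measure R, forall t, t2 <= t -> u t = 0} &
        mild_solution t1 x0 u 0].

End Rigging.

(* Main.v *)
Require Import Defs.
From HB Require Import structures.
From mathcomp Require Import all_boot all_order all_algebra.
From mathcomp Require Import sesquilinear spectral.
From mathcomp Require Import complex.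
From mathcomp Require Import all_classical all_reals all_analysis.
From mathcomp Require Import measurable_realfun.
From mathcomp Require Import ring lra.

Set Implicit Arguments.
Unset Strict Implicit.
Unset Printing Implicit Defensive.

Import Order.TTheory GRing.Theory Num.Theory.
Import numFieldNormedType.Exports.

Local Open Scope classical_set_scope.
Local Open Scope complex_scope.
Local Open Scope ring_scope.

(** Everything is read off the coordinates (x, psi_j). A semigroup acts on them
    by multiplication, (S(t) x, psi_j) = exp(lam_j t) (x, psi_j)
    ([dot_semigroup]), and so does its extension to V ([duality_semigroup]).
    Pairing with psi_j is a bounded functional on V, hence passes under the
    Bochner integral, and the j-th coordinate of the mild solution at time t is
      exp(lam_j t) ((x0, psi_j) + int_0^t u(tau) exp(-lam_j tau) b_j dtau)
    ([duality_input_term]). Put e_j(t) = exp(-lam_j t) b_j. A control that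
    vanishes after t1 - T and steers x0 to 0 at time t1 therefore solves the
    moment problem int_0^(t1-T) u e_j = - (x0, psi_j) for all j.

    Necessity. For x0 = phi_j such a control u satisfies int u e_j = -1 and
    int u e_k = 0 for k <> j, so every y in the span of the e_k, k <> j, has
    int u (e_j - y) = -1. This bounds the distance from e_j to that span from
    below.

    Sufficiency. Strong minimality of a sequence is a uniform lower bound
    l sum |a_i|^2 <= |sum a_i x_i|^2 over all finite combinations
    ([strongly_minimal_bound]). It is used twice.

    - For (phi_j): since S(T+1) x0 is the sum of its expansion, whose
      coefficients are exp(lam_j (T+1)) (x0, psi_j) by biorthogonality
      ([biorthogonal_expansion]), these coefficients are square summable
      ([square_summable_coefficients]). The lower bound on Re lam_j then makes
      (x0, psi_j) itself square summable.
    - For (e_j): a moment problem with square summable data has a solution in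
      L2 ([L2_moment_problem]). It is the limit of the solutions of minimal
      norm of the first n equations, which is where completeness of L2
      ([L2_complete]) is needed.

    The control so obtained brings x0 at time t1 - T to a state y, in X by
    admissibility, with (y, psi_j) = 0 for all j. The expansion of S(t) y then
    vanishes for every t > T, and by right continuity S(T) y = 0. Letting the
    system run freely from t1 - T to t1 reaches S(T) y = 0.

    The formula for the coordinates is an instance of the uniqueness of the
    solution of a scalar differential equation, known here only through right
    derivatives; it rests on a mean value argument
    ([right_derivative0_constant]) that needs left continuity of the orbits.
    This comes from the Baire category theorem ([orbit_left_continuous]). *)

(** * Norms as real numbers *)

Section RealNorm.
Variables (R : realType) (E : normedModType R[i]).
Implicit Types x y : E.

Lemma rnormE x : `|x| = (rnorm x)%:C.
Proof. by rewrite /rnorm RRe_real// normr_real. Qed.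

Lemma rnorm_ge0 x : 0 <= rnorm x.
Proof. by rewrite -ler0c -rnormE. Qed.

Lemma rnorm0 : rnorm (0 : E) = 0.
Proof. by rewrite /rnorm normr0. Qed.

Lemma rnorm0_eq0 x : rnorm x = 0 -> x = 0.
Proof. by move=> x0; apply/normr0_eq0; rewrite rnormE x0. Qed.

Lemma rnormN x : rnorm (- x) = rnorm x.
Proof. by rewrite /rnorm normrN. Qed.

Lemma rnorm_distC x y : rnorm (x - y) = rnorm (y - x).
Proof. by rewrite -rnormN opprB. Qed.

Lemma ler_rnormD x y : rnorm (x + y) <= rnorm x + rnorm y.
Proof. by rewrite -lecR rmorphD/= -!rnormE ler_normD. Qed.

Lemma ler_rdistD z x y : rnorm (x - y) <= rnorm (x - z) + rnorm (z - y).
Proof. by rewrite (le_trans _ (ler_rnormD _ _))// addrA subrK. Qed.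

Lemma rnormZ (a : R[i]) x : rnorm (a *: x) = complex.Re `|a| * rnorm x.
Proof.
by rewrite /rnorm normrZ rnormE; case: (`|a|) => u v /=; rewrite mulr0 subr0.
Qed.

Lemma cvg_rnormP (T : Type) (F : set_system T) (f : T -> E) (l : E) :
  Filter F ->
  f @ F --> l <-> forall e : R, 0 < e -> \forall t \near F, rnorm (l - f t) < e.
Proof.
move=> FF; split=> [/cvgrPdist_lt fl e e0|fl].
  have := fl e%:C; rewrite ltcR => /(_ e0); apply: filterS => t.
  by rewrite rnormE ltcR.
apply/cvgrPdist_lt => e; rewrite ltcE/= => /andP[/eqP ie re].
have := fl _ re; apply: filterS => t.
by rewrite rnormE ltcE/= -ie eqxx.
Qed.

End RealNorm.

Lemma linear_rnorm_bounded (R : realType) (E F : normedModType R[i])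
    (L : {linear E -> F}) :
  continuous L -> exists2 K : R, 0 < K & forall x, rnorm (L x) <= K * rnorm x.
Proof.
move=> /linear_bounded_continuous/linear_boundedP[M [Mr LM]].
have MRe : M = (complex.Re M)%:C by rewrite RRe_real.
exists (`|complex.Re M| + 1); first by rewrite ltr_wpDl.
move=> x; have := LM (`|complex.Re M| + 1)%:C.
have Mlt : M < (`|complex.Re M| + 1)%:C.
  by rewrite MRe ltcR (le_lt_trans (ler_norm _))// ltrDl.
move=> /(_ Mlt x); rewrite /= !rnormE => H.
by rewrite -lecR [leRHS]rmorphM.
Qed.

(** * One-sided limits and constancy *)

Section Near.
Variable R : realType.

Lemma near_right0P (P : R -> Prop) :
  (\forall h \near (0 : R)^'+, P h) <->
  exists2 d : R, 0 < d & forall h, 0 < h -> h < d -> P h.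
Proof.
split.
  move=> [d /= d0 dP]; exists d => // h h0 hd; apply: dP => //=.
  by rewrite sub0r normrN gtr0_norm.
move=> [d d0 dP]; exists d => //= h /=; rewrite sub0r normrN => hd h0.
by apply: dP => //; rewrite gtr0_norm in hd.
Qed.

Lemma near_leftP (t : R) (P : R -> Prop) :
  (\forall s \near t^'-, P s) <->
  exists2 d : R, 0 < d & forall h, 0 < h -> h < d -> P (t - h).
Proof.
split.
  move=> [d /= d0 dP]; exists d => // h h0 hd; apply: dP => //=.
    by rewrite opprB addrC subrK gtr0_norm.
  by rewrite ltrBlDr ltrDl.
move=> [d d0 dP]; exists d => //= s /= hd st.
have -> : s = t - (t - s) by rewrite opprB addrC subrK.
by apply: dP; rewrite ?subr_gt0// (le_lt_trans (ler_norm _)).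
Qed.

End Near.

Section MeanValue.
Variables (R : realType) (E : normedModType R[i]).

(** Fix e > 0 and let s be the supremum of the times t up to which
    |g r - g 0| <= e r. Left continuity carries the estimate to s itself, and
    the right derivative at s, being 0, carries it beyond s unless s = b. *)
Lemma right_derivative0_constant (g : R -> E) (b : R) : 0 <= b ->
  (forall t, 0 < t -> t <= b -> g s @[s --> t^'-] --> g t) ->
  (forall t, 0 <= t -> t < b ->
     (h^-1)%:C *: (g (t + h) - g t) @[h --> 0^'+] --> 0) ->
  g b = g 0.
Proof.
move=> b0 gl gr.
suff key e : 0 < e -> rnorm (g b - g 0) <= e * b.
  apply/eqP; rewrite -subr_eq0; apply/eqP/rnorm0_eq0/eqP.
  rewrite eq_le rnorm_ge0 andbT; apply/ler_addgt0Pr => e e0.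
  rewrite add0r (le_trans (key (e / (b + 1)) _))//.
    by rewrite divr_gt0// ltr_wpDl.
  by rewrite mulrAC ler_pdivrMr ?ltr_wpDl// ler_pM2l// lerDl.
move=> e0.
pose A := [set t | 0 <= t <= b /\
  forall r, 0 <= r -> r <= t -> rnorm (g r - g 0) <= e * r].
have A0 : A 0.
  split; first by rewrite lexx.
  move=> r r0 rle; have -> : r = 0 by apply/le_anti; rewrite r0 rle.
  by rewrite subrr rnorm0 mulr0.
have supA : has_sup A.
  by split; [exists 0|exists b => t [/andP[]]].
pose s := sup A.
have s0 : 0 <= s by apply: ub_le_sup => //; exact: supA.2.
have sb : s <= b by apply: ge_sup; [exists 0|move=> t [/andP[]]].
have below r : 0 <= r -> r < s -> rnorm (g r - g 0) <= e * r.
  move=> r0 rs; have sr : 0 < s - r by rewrite subr_gt0.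
  have [t [tb tA]] := sup_adherent sr supA.
  by rewrite opprB addrC subrK => /ltW rt; exact: tA.
have Ps : rnorm (g s - g 0) <= e * s.
  move: s0; rewrite le_eqVlt => /predU1P[<-|s0].
    by rewrite subrr rnorm0 mulr0.
  apply/ler_addgt0Pr => e' e'0.
  have /cvg_rnormP/(_ _ e'0)/near_leftP[d d0 dP] := gl s s0 sb.
  pose h := Num.min (d / 2) (s / 2).
  have h0 : 0 < h by rewrite lt_min !divr_gt0.
  have hd : h < d by rewrite gt_min; apply/orP; left; lra.
  have hs : h < s by rewrite gt_min; apply/orP; right; lra.
  rewrite [leRHS]addrC (le_trans (ler_rdistD (g (s - h)) _ _))//.
  rewrite lerD//; first exact/ltW/dP.
  rewrite (le_trans (below _ _ _))//; first by rewrite subr_ge0 ltW.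
    by rewrite ltrBlDr ltrDl.
  by rewrite ler_pM2l// lerBlDr lerDl ltW.
suff -> : b = s by [].
apply/le_anti; rewrite sb andbT leNgt; apply/negP => sltb.
have /cvg_rnormP/(_ _ e0)/near_right0P[d d0 dP] := gr s s0 sltb.
(* The estimate holds up to s + h, against the choice of s. *)
pose h := Num.min (d / 2) (b - s).
have h0 : 0 < h by rewrite lt_min divr_gt0//= subr_gt0.
have hd : h < d by rewrite gt_min; apply/orP; left; lra.
have hbs : h <= b - s by rewrite ge_min lexx orbT.
have : A (s + h).
  split; first by rewrite addr_ge0 ?(ltW h0)//= -lerBrDl.
  move=> r r0 rsh; have [rs|sr] := ltP r s; first exact: below.
  have [->//|rs] := eqVneq r s.
  have rs0 : 0 < r - s by rewrite subr_gt0 lt_neqAle eq_sym rs.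
  have := dP (r - s) rs0; rewrite sub0r rnormN rnormZ.
  rewrite normc_def /= expr0n/= addr0 sqrtr_sqr normfV (gtr0_norm rs0).
  rewrite (_ : s + (r - s) = r); last by rewrite addrC subrK.
  rewrite ltr_pdivrMl// => /(_ _)/ltW Hr.
  rewrite (le_trans (ler_rdistD (g s) _ _))//.
  rewrite (le_trans (lerD (Hr _) Ps))//; first by rewrite (le_lt_trans _ hd)// lerBlDl.
  by rewrite mulrC -mulrDr subrK.
move=> /(ub_le_sup supA.2); rewrite -/s; apply/negP; rewrite -ltNge.
by rewrite ltrDl.
Qed.

End MeanValue.

(** * Continuity of semigroup orbits *)

Section Orbit.
Variables (R : realType) (E : completeNormedModType R[i]).

(** Let F n be the set of points near which f varies by less than 1/(n+1). It
    is open, and it is dense because right continuity at p puts points p + m/2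
    in it, with m arbitrarily small. Points common to all F n are continuity
    points, and they are dense by the Baire category theorem. *)
Lemma right_continuous_continuity_point (f : R -> E) (a b : R) : a < b ->
  (forall t, f (t + h) @[h --> 0^'+] --> f t) ->
  exists2 t, a < t < b & f s @[s --> t] --> f t.
Proof.
move=> ab fr.
pose F (n : nat) : set R^o := [set p | exists2 d : R, 0 < d &
  forall y z : R, `|p - y| < d -> `|p - z| < d ->
    rnorm (f y - f z) < n.+1%:R^-1].
have oF n : open (F n).
  rewrite openE => p [d d0 dF]; apply/nbhs_ballP.
  exists (d / 2) => /=; first by rewrite divr_gt0.
  move=> q; rewrite /ball/= => pq; exists (d / 2); first by rewrite divr_gt0.
  have dd y : `|q - y| < d / 2 -> `|p - y| < d.
    move=> qy; rewrite -(subrK q p) -addrA (le_lt_trans (ler_normD _ _))//.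
    by rewrite [ltRHS](splitr d) ltrD.
  by move=> y z /dd ? /dd ?; exact: dF.
have dF n : dense (F n).
  move=> D [p Dp] oD.
  have /nbhs_ballP[r /= r0 rD] : nbhs p D by exact: open_nbhs_nbhs.
  have e0 : 0 < n.+1%:R^-1 / 2 :> R by rewrite divr_gt0// invr_gt0.
  have /cvg_rnormP/(_ _ e0)/near_right0P[d d0 dP] := fr p.
  pose m := Num.min r d; have m0 : 0 < m by rewrite lt_min r0.
  have mr : m <= r by rewrite ge_min lexx.
  have md : m <= d by rewrite ge_min lexx orbT.
  exists (p + m / 2); split.
    apply: rD; rewrite /ball/= opprD addNKr normrN gtr0_norm ?divr_gt0//.
    by lra.
  exists (m / 2); first by rewrite divr_gt0.
  have near_p y : `|p + m / 2 - y| < m / 2 -> rnorm (f p - f y) < n.+1%:R^-1 / 2.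
    rewrite ltr_norml => /andP[y1 y2].
    have -> : y = p + (y - p) by rewrite addrC subrK.
    by apply: dP; lra.
  move=> y z /near_p py /near_p pz.
  rewrite (le_lt_trans (ler_rdistD (f p) _ _))// [ltRHS](splitr _) ltrD//.
  by rewrite rnorm_distC.
have := @Baire R R^o F (fun n => conj (oF n) (dF n)).
move=> /(_ `]a, b[%classic); case.
- by exists ((a + b) / 2); rewrite /= in_itv/=; lra.
- exact: itv_open.
move=> t [/=]; rewrite in_itv/= => tab tF; exists t => //.
apply/cvg_rnormP => e e0.
have [n] : exists n : nat, n.+1%:R^-1 < e.
  exists (Num.trunc e^-1); rewrite invf_plt ?posrE//.
  exact: truncnS_gt.
have [d d0 dt] := tF n I => ne.
exists d => //= s ts; rewrite (lt_trans _ ne)//; apply: dt => //.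
by rewrite subrr normr0.
Qed.

Variable S : R -> {linear E -> E}.
Hypothesis hS : C0_semigroup S.

Lemma orbit_right_continuous t x : 0 <= t ->
  S (t + h) x @[h --> 0^'+] --> S t x.
Proof.
have [Sc _ SD S0] := hS; move=> t0.
have : S t (S h x) @[h --> 0^'+] --> S t x.
  by apply: (cvg_comp _ _ (S0 x)); exact: Sc.
apply: cvg_trans; apply: near_eq_cvg.
by near=> h; rewrite SD.
Unshelve. all: by end_near. Qed.

(** Some q in ]0, t[ is a continuity point of the orbit, and near t the orbit
    is the image of the orbit near q by the single bounded operator S(t - q).
    No bound on |S(t)| uniform for t in an interval is involved. *)
Lemma orbit_left_continuous t x : 0 < t -> S s x @[s --> t^'-] --> S t x.
Proof.
have [Sc _ SD _] := hS; move=> t0.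
(* The orbit is extended by a constant to negative times, where S is
   arbitrary, to be right continuous on the whole line. *)
have [|q /andP[q0 qt] /cvg_rnormP fq] :=
    @right_continuous_continuity_point (fun s => S (Num.max s 0) x) 0 t t0.
  move=> p; have [p0|p0] := leP 0 p.
    have := @orbit_right_continuous p x p0.
    apply: cvg_trans; apply: near_eq_cvg; near=> h.
    by rewrite max_l// addr_ge0.
  apply/cvg_rnormP => e e0; apply/near_right0P; exists (- p); first by rewrite oppr_gt0.
  by move=> h h0 hp; rewrite max_r ?subrr ?rnorm0//; lra.
have tq0 : 0 <= t - q by rewrite subr_ge0 ltW.
have [K K0 LK] := linear_rnorm_bounded (Sc _ tq0).
apply/cvg_rnormP => e e0; apply/near_leftP.
have eK : 0 < e / K by rewrite divr_gt0.
have [d /= d0 dP] := fq _ eK.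
exists (Num.min d q); first by rewrite lt_min d0.
move=> h h0; rewrite lt_min => /andP[hd hq].
rewrite (_ : S t x = S (t - q) (S q x)); last first.
  by rewrite -SD ?subrK// ltW.
rewrite (_ : S (t - h) x = S (t - q) (S (q - h) x)); last first.
  by rewrite -SD//; [rewrite addrA subrK|rewrite subr_ge0 ltW].
rewrite -linearB (le_lt_trans (LK _))// -ltr_pdivlMl// mulrC.
have := dP (q - h); rewrite /ball_ /= opprB addrC subrK gtr0_norm// => /(_ hd).
by rewrite !max_l// ?subr_ge0 ltW.
Unshelve. all: by end_near. Qed.

End Orbit.

(** * The complex exponential *)

Section ComplexExp.
Variable R : realType.
Implicit Types z w : R[i].

Lemma cexpD z w : cexp (z + w) = cexp z * cexp w.
Proof.
case: z w => [a b] [c d]; rewrite /cexp /= expRD cosD sinD.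
by apply/eqP; rewrite eq_complex /=; apply/andP; split; apply/eqP; ring.
Qed.

Lemma cexp0 : cexp (0 : R[i]) = 1.
Proof. by rewrite /cexp /= expR0 cos0 sin0 mul1r. Qed.

Lemma cexpNK z : cexp (- z) * cexp z = 1.
Proof. by rewrite -cexpD addNr cexp0. Qed.

Lemma Re_norm (z : R[i]) : complex.Re `|z| = Num.sqrt (complex.Re z ^+ 2 + complex.Im z ^+ 2).
Proof. by rewrite normc_def. Qed.

Lemma Re_norm_sqr (z : R[i]) :
  complex.Re `|z| ^+ 2 = complex.Re z ^+ 2 + complex.Im z ^+ 2.
Proof. by rewrite Re_norm sqr_sqrtr// addr_ge0// sqr_ge0. Qed.

Lemma Re_norm_cexp z : complex.Re `|cexp z| = expR (complex.Re z).
Proof.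
case: z => a b; rewrite Re_norm /cexp /=.
rewrite !mul0r subr0 addr0 !exprMn -mulrDr cos2Dsin2 mulr1 sqrtr_sqr.
by rewrite gtr0_norm ?expR_gt0.
Qed.

Lemma Re_norm_le z : complex.Re `|z| <= `|complex.Re z| + `|complex.Im z|.
Proof.
rewrite Re_norm -(@ger0_norm _ (`|_| + `|_|)) ?addr_ge0// -sqrtr_sqr.
rewrite ler_wsqrtr// sqrrD !real_normK ?num_real//.
by rewrite lerD2r lerDl mulrn_wge0// mulr_ge0.
Qed.

Lemma cvg_complex (T : Type) (F : set_system T) (f : T -> R[i]^o) (l : R[i]^o) :
  Filter F ->
  complex.Re (f t) @[t --> F] --> complex.Re l ->
  complex.Im (f t) @[t --> F] --> complex.Im l ->
  f @ F --> l.
Proof.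
move=> FF /cvgrPdist_lt fR /cvgrPdist_lt fI; apply/cvg_rnormP => e e0.
have e2 : 0 < e / 2 by rewrite divr_gt0.
apply: filterS2 (fR _ e2) (fI _ e2) => t tR tI.
rewrite (le_lt_trans (Re_norm_le _))// [ltRHS](splitr e).
have -> : complex.Re (l - f t : R[i]) = complex.Re l - complex.Re (f t).
  by case: (l) => ? ?; case: (f t).
have -> : complex.Im (l - f t : R[i]) = complex.Im l - complex.Im (f t).
  by case: (l) => ? ?; case: (f t).
exact: ltrD.
Qed.

Lemma cexp_derive0 z :
  (((h^-1)%:C * (cexp (z * h%:C) - 1) : R[i]^o) @[h --> 0^'+] --> (z : R[i]^o)).
Proof.
case: z => a b.
have dR : is_derive (0 : R) 1 (fun h : R => expR (a * h) * cos (b * h)) a.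
  apply: is_derive_eq.
  by rewrite !mulr0 expR0 cos0 sin0 /GRing.scale /=; ring.
have dI : is_derive (0 : R) 1 (fun h : R => expR (a * h) * sin (b * h)) b.
  apply: is_derive_eq.
  by rewrite !mulr0 expR0 cos0 sin0 /GRing.scale /=; ring.
have slope (f : R -> R) (l : R) : is_derive (0 : R) 1 f l ->
    h^-1 * (f h - f 0) @[h --> 0^'+] --> l.
  move=> [fd <-]; apply: cvg_dnbhs_at_right.
  move/cvg_ex : (fd) => [m fm]; rewrite /derive (cvg_lim _ fm)//.
  apply: cvg_trans fm; apply: near_eq_cvg; near=> h.
  by rewrite /= addr0 /GRing.scale /= mulr1.
apply: cvg_complex => /=.
- apply: cvg_trans (slope _ _ dR); apply: near_eq_cvg; near=> h.
  by rewrite !mulr0 expR0 cos0 /= subr0 add0r; ring.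
- apply: cvg_trans (slope _ _ dI); apply: near_eq_cvg; near=> h.
  by rewrite /= !mulr0 !subr0 !add0r expR0 sin0 ?mulr0 ?subr0; ring.
Unshelve. all: by end_near. Qed.

Lemma cexp_continuous_real z (t : R) :
  (cexp (z * s%:C) : R[i]^o) @[s --> t] --> (cexp (z * t%:C) : R[i]^o).
Proof.
case: z => a b.
have cM (c : R) : (c * s) @[s --> t] --> c * t.
  exact: (@mulrl_continuous R c t).
have cE : expR (a * s) @[s --> t] --> expR (a * t).
  exact: (cvg_comp _ _ (cM a) (@continuous_expR R (a * t))).
have cC : cos (b * s) @[s --> t] --> cos (b * t).
  exact: (cvg_comp _ _ (cM b) (@continuous_cos R (b * t))).
have cS : sin (b * s) @[s --> t] --> sin (b * t).
  exact: (cvg_comp _ _ (cM b) (@continuous_sin R (b * t))).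
have E (s : R) : cexp ((a +i* b) * s%:C) =
    (expR (a * s) * cos (b * s)) +i* (expR (a * s) * sin (b * s)).
  apply/eqP; rewrite eq_complex /cexp /= !mulr0 subr0 !mul0r subr0 addr0 add0r.
  by rewrite !eqxx.
rewrite E.
apply: cvg_complex.
- by under eq_fun do rewrite E; exact: cvgM cE cC.
- by under eq_fun do rewrite E; exact: cvgM cE cS.
Qed.

End ComplexExp.

(** * Complex moduli and the Cauchy-Schwarz inequality *)

Lemma Re_normK (R : realType) (z : R[i]) : (complex.Re `|z|)%:C = `|z|.
Proof. by rewrite RRe_real// normr_real. Qed.

Section RealInComplex.
Variable R : realType.
Implicit Types x y : R.

Lemma realcD x y : (x + y)%:C = x%:C + y%:C :> R[i].
Proof. exact: rmorphD. Qed.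

Lemma realcN x : (- x)%:C = - x%:C :> R[i].
Proof. exact: rmorphN. Qed.

Lemma realcB x y : (x - y)%:C = x%:C - y%:C :> R[i].
Proof. exact: rmorphB. Qed.

Lemma realcM x y : (x * y)%:C = x%:C * y%:C :> R[i].
Proof. exact: rmorphM. Qed.

Lemma realcX x n : (x ^+ n)%:C = x%:C ^+ n :> R[i].
Proof. exact: rmorphXn. Qed.

Lemma realc_sum I (r : seq I) (P : pred I) (F : I -> R) :
  (\sum_(i <- r | P i) F i)%:C = \sum_(i <- r | P i) (F i)%:C :> R[i].
Proof. exact: rmorph_sum. Qed.

Lemma conj_realc x : Num.conj x%:C = x%:C :> R[i].
Proof. exact: conjc_real. Qed.

End RealInComplex.

Lemma Re_norm_conj (R : realType) (z : R[i]) :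
  (complex.Re `|z| ^+ 2)%:C = z * Num.conj z.
Proof. by rewrite realcX Re_normK normCK. Qed.

Section ReNorm.
Variable R : realType.
Implicit Types z w : R[i].

Lemma Re_norm_ge0 z : 0 <= complex.Re `|z|.
Proof. by rewrite -ler0c Re_normK. Qed.

Lemma Re_norm_eq0 z : complex.Re `|z| = 0 -> z = 0.
Proof. by move=> z0; apply/normr0_eq0; rewrite -Re_normK z0. Qed.

Lemma Re_normD z w : complex.Re `|z + w| <= complex.Re `|z| + complex.Re `|w|.
Proof. by rewrite -lecR realcD !Re_normK ler_normD. Qed.

Lemma Re_normN z : complex.Re `|- z| = complex.Re `|z|.
Proof. by rewrite normrN. Qed.

Lemma Re_normB z w : complex.Re `|z - w| <= complex.Re `|z| + complex.Re `|w|.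
Proof. by rewrite -(Re_normN w) Re_normD. Qed.

Lemma Re_normM z w : complex.Re `|z * w| = complex.Re `|z| * complex.Re `|w|.
Proof. by apply: complexI; rewrite realcM !Re_normK normrM. Qed.

Lemma Re_norm_conjE z : complex.Re `|Num.conj z| = complex.Re `|z|.
Proof. by rewrite norm_conjC. Qed.

End ReNorm.

Section Dot.
Variables (R : realType) (X : completeNormedModType R[i]).
Variable dot : {dot X for Num.conj}.
Hypothesis hdot : inner_product_norm dot.

Lemma dotC x y : dot x y = Num.conj (dot y x).
Proof. by rewrite hermC expr0 mul1r. Qed.

Lemma dotrnorm x : dot x x = (rnorm x ^+ 2)%:C.
Proof. by rewrite -hdot rnormE rmorphXn. Qed.

(** Expand 0 <= (v, v) for v = |y|^2 x - (x, y) y, which is |y|^2 times the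
    component of x orthogonal to y. *)
Lemma rnorm_dot x y : complex.Re `|dot x y| <= rnorm x * rnorm y.
Proof.
have [->|y0] := eqVneq y 0.
  by rewrite linear0r normr0 rnorm0 mulr0.
have yp : 0 < rnorm y ^+ 2.
  by rewrite -ltcR -dotrnorm lt_neqAle eq_sym dnorm_eq0 y0 dnorm_ge0.
have : 0 <= dot ((rnorm y ^+ 2)%:C *: x - dot x y *: y)
              ((rnorm y ^+ 2)%:C *: x - dot x y *: y) by exact: dnorm_ge0.
rewrite dnormB !dnormZ linearZl_LR linearZr_LR /=.
rewrite !dotrnorm.
set d := dot x y; set r := rnorm y ^+ 2; set q := rnorm x ^+ 2.
have -> : r%:C * (Num.conj d * d) = (r * complex.Re `|d| ^+ 2)%:C.
  by rewrite realcM; congr (_ * _); rewrite mulrC; exact/esym/Re_norm_conj.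
rewrite conj_realc.
have -> : `|d| ^+ 2 = (complex.Re `|d| ^+ 2)%:C by rewrite normCK; exact/esym/Re_norm_conj.
have -> : `|r%:C| = r%:C by rewrite ger0_norm// ler0c ltW.
rewrite -!realcX -!realcM -!realcD -realcB ler0c => H.
have : 0 <= r * (r * q - complex.Re `|d| ^+ 2) by rewrite (le_trans H)//; lra.
rewrite pmulr_rge0// subr_ge0 /r /q -exprMn mulrC.
rewrite ler_sqr// ?nnegrE ?mulr_ge0 ?rnorm_ge0//.
by rewrite -ler0c Re_normK.
Qed.
End Dot.

(** * Eigenvectors of the adjoint under the semigroup *)

Section DotCvg.
Variables (R : realType) (X : completeNormedModType R[i]).
Variable dot : {dot X for Num.conj}.
Hypothesis hdot : inner_product_norm dot.

Lemma cvg_dotl (T : Type) (F : set_system T) (f : T -> X) (l y : X) : Filter F ->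
  f @ F --> l -> (dot (f t) y : R[i]^o) @[t --> F] --> (dot l y : R[i]^o).
Proof.
move=> FF /cvg_rnormP fl; apply/cvg_rnormP => e e0.
have y1 : 0 < rnorm y + 1 by rewrite ltr_wpDl// rnorm_ge0.
apply: filterS (fl _ (divr_gt0 e0 y1)) => t; rewrite ltr_pdivlMr// => lt.
rewrite (_ : dot l y - dot (f t) y = dot (l - f t) y); last by rewrite linearBl.
apply: le_lt_trans lt; apply: le_trans (rnorm_dot hdot _ _) _.
by rewrite ler_wpM2l ?rnorm_ge0// lerDl.
Qed.

Variable S : R -> {linear X -> X}.
Hypothesis hS : C0_semigroup S.

(** The function g(s) = exp(-z s) (S(s) x, psi) is left continuous and has
    right derivative 0, because the derivative of S(s) x is A S(s) x and
    (A S(s) x, psi) = z (S(s) x, psi). *)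
Lemma dot_semigroup_domain (z : R[i]) (psi : X) :
  adjoint dot (generator S) (psi, Num.conj z *: psi) ->
  forall x t, op_dom (generator S) x -> 0 <= t ->
  dot (S t x) psi = cexp (z * t%:C) * dot x psi.
Proof.
move=> adj x t [Ax xAx] t0; have [Sc Sid SD S0] := hS.
pose g (s : R) : R[i]^o := cexp (- z * s%:C) * dot (S s x) psi.
have -> : dot x psi = g 0 by rewrite /g mulr0 cexp0 mul1r Sid.
suff <- : g t = g 0.
  by rewrite /g mulrA mulNr -cexpD addrN cexp0 mul1r.
apply: right_derivative0_constant => //.
  move=> s s0 st.
  apply: (@cvgM (R[i]^o) _ _ _ (fun s => cexp (- z * s%:C)) (fun s => dot (S s x) psi)).
    have ce := cvg_at_left_filter (@cexp_continuous_real R (- z) s).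
    exact: ce.
  exact: cvg_dotl (orbit_left_continuous hS s0).
move=> s s0 st.
pose y := S s x; pose Ay := S s Ax.
have yAy : generator S (y, Ay).
  rewrite /generator /=.
  have : S s ((h^-1)%:C *: (S h x - x)) @[h --> 0^'+] --> Ay.
    by apply: (cvg_comp _ _ xAx); exact: Sc.
  apply: cvg_trans; apply: near_eq_cvg; near=> h.
  by rewrite linearZ linearB /= /y -!SD// [s + h]addrC.
have Ayz : dot Ay psi = z * dot y psi.
  by have /= -> := adj _ yAy; rewrite linearZr_LR /= conjCK.
have lim1 : (dot ((h^-1)%:C *: (S h y - y)) psi : R[i]^o) @[h --> 0^'+] -->
    (z * dot y psi : R[i]^o).
  by rewrite -Ayz; exact: cvg_dotl yAy.
have lim2 := @cexp_derive0 R (- z).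
have lim3 : (cexp (- z * h%:C) : R[i]^o) @[h --> 0^'+] --> (1 : R[i]^o).
  have := @cexp_continuous_real R (- z) 0; rewrite mulr0 cexp0.
  by move/cvg_at_right_filter.
(* The difference quotient of g at s is exp(-z s) times
   exp(-z h) (A_h y, psi) + h^-1 (exp(-z h) - 1) (y, psi), with y = S(s) x and
   A_h = h^-1 (S(h) - 1). *)
pose proof (cvgM lim3 lim1) as lim4.
pose proof (cvgMr_tmp (b := dot y psi) lim2) as lim5.
pose proof (cvgD lim4 lim5) as lim6; move: lim6.
rewrite mul1r mulNr addrN.
move/(cvgMl_tmp (a := cexp (- z * s%:C))); rewrite mulr0.
apply: cvg_trans; apply: near_eq_cvg; near=> h.
rewrite fctE /= linearZl_LR linearBl /= -?/y.
have -> : S h y = S (s + h) x by rewrite addrC SD.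
rewrite /g -/y realcD (mulrDr (- z)) cexpD.
move: (cexp _) (cexp _) (dot _ _) (dot _ _) (h^-1)%:C => a b c d e.
change (b * (a * (e * (d - c)) + e * (a - 1) * c) = e * (b * a * d - b * c)).
by ring.
Unshelve. all: by end_near. Qed.

(** Any y is mu x - A x with x in the domain. Then (y, psi) = (mu - z) (x, psi),
    and likewise for S(t) y and S(t) x, since A commutes with S(t). The formula
    for y thus follows from the one for x, without density of the domain. *)
Lemma dot_semigroup (z mu : R[i]) (psi : X) :
  adjoint dot (generator S) (psi, Num.conj z *: psi) ->
  resolvent_set (generator S) mu ->
  forall x t, 0 <= t -> dot (S t x) psi = cexp (z * t%:C) * dot x psi.
Proof.
move=> adj [surj _] y t t0; have [Sc Sid SD S0] := hS.
have [x [xy _]] := surj y.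
have xdom : op_dom (generator S) x by exists (mu *: x - y).
have St_dom : generator S (S t x, mu *: S t x - S t y).
  rewrite /generator /=.
  have : S t ((h^-1)%:C *: (S h x - x)) @[h --> 0^'+] --> S t (mu *: x - y).
    by apply: (cvg_comp _ _ xy); exact: Sc.
  rewrite linearB linearZ /=.
  apply: cvg_trans; apply: near_eq_cvg; near=> h.
  by rewrite linearZ linearB /= -!SD// [t + h]addrC.
have Ex : dot y psi = (mu - z) * dot x psi.
  have := adj _ xy; rewrite /= linearZr_LR /= conjCK linearBl linearZl_LR /= => H.
  by rewrite mulrBl -H opprB addrC subrK.
have Et : dot (S t y) psi = (mu - z) * dot (S t x) psi.
  have := adj _ St_dom; rewrite /= linearZr_LR /= conjCK linearBl linearZl_LR /= => H.
  by rewrite mulrBl -H opprB addrC subrK.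
by rewrite Et Ex (dot_semigroup_domain adj)// mulrCA.
Unshelve. all: by end_near. Qed.
End DotCvg.

(** If the spectrum were all of C, then 0 would be a limit point of it. *)
Lemma resolvent_set_nonempty (R : realType) (X : completeNormedModType R[i])
    (A : set (X * X)) :
  limit_point (spectrum A : set R[i]^o) = set0 -> exists mu, resolvent_set A mu.
Proof.
move=> lp0; apply: contrapT => /forallNP noR.
suff : limit_point (spectrum A : set R[i]^o) 0 by rewrite lp0.
move=> U /nbhs_ballP[e /= e0 eU].
move: e0; rewrite ltcE/= => /andP[/eqP ie re].
exists (complex.Re e / 2)%:C; split.
- by rewrite gt_eqF// ltcR divr_gt0.
- exact: noR.
- apply: eU; rewrite -ball_normE /ball_ /= sub0r normrN.
  rewrite ger0_norm ?ler0c ?divr_ge0 ?ltW//.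
  by rewrite ltcE /= -ie eqxx/=; lra.
Qed.

(** * The pairing with the domain of the adjoint *)

Lemma dense_eq0 (R : realType) (V : normedModType R[i]) (D : set V)
    (f : V -> R[i]) (C : R) : dense D ->
  (forall v w, f (v - w) = f v - f w) ->
  (forall v, complex.Re `|f v| <= C * rnorm v) ->
  (forall v, D v -> f v = 0) -> forall v, f v = 0.
Proof.
move=> dD fB fC f0 v; apply/normr0_eq0; rewrite -Re_normK.
suff -> : complex.Re `|f v| = 0 by [].
apply/le_anti/andP; split; last exact: Re_norm_ge0.
apply/ler_addgt0Pr => e e0; rewrite add0r.
have C1 : 0 < `|C| + 1 by rewrite ltr_wpDl.
have ec : 0 < (e / (`|C| + 1))%:C by rewrite ltcR divr_gt0.
have ne : ball v (e / (`|C| + 1))%:C !=set0 by exists v; exact: ballxx.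
have op : open (ball v (e / (`|C| + 1))%:C) by exact: ball_open.
have [w [vw Dw]] := dD _ ne op.
have -> : f v = f (v - w) by rewrite fB (f0 w)// subr0.
move: vw; rewrite -ball_normE /ball_ /= rnormE ltcR ltr_pdivlMr// => vw.
rewrite (le_trans (fC _))// (le_trans _ (ltW vw))// mulrC ler_wpM2l ?rnorm_ge0//.
by rewrite (le_trans (ler_norm _))// lerDl.
Qed.

Section Duality.
Variables (R : realType) (X V : completeNormedModType R[i]).
Variables (dot : {dot X for Num.conj}) (iota : {linear X -> V}).
Variable duality : V -> X -> R[i].
Variable B : set (X * X).
Hypothesis hdual : antidual_of_domain dot iota duality B.

Lemma dualityPl w a v1 v2 : op_dom B w ->
  duality (a *: v1 + v2) w = a * duality v1 w + duality v2 w.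
Proof. by case: hdual => H _ _ _ _ Bw; exact: H. Qed.

Lemma duality_iota x w : op_dom B w -> duality (iota x) w = dot x w.
Proof. by case: hdual => _ _ _ _; exact. Qed.

Lemma dualityBl w v1 v2 : op_dom B w ->
  duality (v1 - v2) w = duality v1 w - duality v2 w.
Proof.
by move=> Bw; rewrite addrC -scaleN1r dualityPl// mulN1r addrC.
Qed.

Lemma duality0l w : op_dom B w -> duality 0 w = 0.
Proof. by move=> Bw; rewrite -(subrr 0) dualityBl// subrr. Qed.

Lemma dualityZl w a v : op_dom B w -> duality (a *: v) w = a * duality v w.
Proof.
by move=> Bw; rewrite -[a *: v]addr0 dualityPl// duality0l// addr0.
Qed.

Lemma dualityDl w v1 v2 : op_dom B w ->
  duality (v1 + v2) w = duality v1 w + duality v2 w.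
Proof. by move=> Bw; rewrite -[v1]scale1r dualityPl// scale1r mul1r. Qed.

Lemma duality_bounded w : op_dom B w ->
  exists2 K : R, 0 <= K & forall v, complex.Re `|duality v w| <= K * rnorm v.
Proof.
move=> [y wy]; exists (graph_norm (w, y)); first exact: sqrtr_ge0.
by move=> v; case: hdual => _ _ /(_ v)[/(_ _ wy) H _] _ _; rewrite mulrC.
Qed.

End Duality.

Section DualSemigroup.
Variables (R : realType) (X V : completeNormedModType R[i]).
Variables (dot : {dot X for Num.conj}) (iota : {linear X -> V}).
Hypothesis hdot : inner_product_norm dot.
Variable duality : V -> X -> R[i].
Variables (S : R -> {linear X -> X}) (SV : R -> {linear V -> V}).
Hypothesis hS : C0_semigroup S.
Hypothesis hdual : antidual_of_domain dot iota duality (adjoint dot (generator S)).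
Hypothesis hSV : semigroup_extension iota S SV.
Hypothesis hdense : dense (range iota).

(** Both sides are continuous in v, and they agree on X, which is dense in
    V. *)
Lemma duality_semigroup (z mu : R[i]) (psi : X) :
  adjoint dot (generator S) (psi, Num.conj z *: psi) ->
  resolvent_set (generator S) mu ->
  forall v t, 0 <= t -> duality (SV t v) psi = cexp (z * t%:C) * duality v psi.
Proof.
move=> adj res v t t0.
have psidom : op_dom (adjoint dot (generator S)) psi by exists (Num.conj z *: psi).
have [[SVc _ _ _] SVi _ _] := hSV.
have [K K0 dK] := duality_bounded hdual psidom.
have [M M0 SM] := linear_rnorm_bounded (SVc t t0).
pose f v := duality (SV t v) psi - cexp (z * t%:C) * duality v psi.
suff : f v = 0 by move/subr0_eq.
have fC u : complex.Re `|f u| <=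
    (K * M + complex.Re `|cexp (z * t%:C)| * K) * rnorm u.
  rewrite (le_trans (Re_normB _ _))// Re_normM mulrDl lerD//.
    rewrite (le_trans (dK _))// -mulrA ler_wpM2l//; exact: SM.
  by rewrite -mulrA ler_wpM2l// Re_norm_ge0.
apply: (dense_eq0 hdense _ fC).
- move=> u w; rewrite /f linearB !(dualityBl hdual)//.
  by rewrite mulrBr !opprB addrACA [RHS]addrACA; congr (_ + _); exact: addrC.
- move=> _ [x _ <-]; rewrite /f SVi// !(duality_iota hdual)//.
  by rewrite (dot_semigroup hdot hS adj res)// subrr.
Qed.

End DualSemigroup.

(** * Bochner integrals *)

Lemma ae_lebesgueS (R : realType) (P Q : R -> Prop) :
  (forall t, P t -> Q t) ->
  {ae @lebesgue_measure R, forall t, P t} ->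
  {ae @lebesgue_measure R, forall t, Q t}.
Proof.
move=> PQ; apply: negligibleS => t /= nQ Pt; apply: nQ; exact: PQ.
Qed.

Section IntegralMonotone.
Import HBNNSimple.
Local Open Scope ereal_scope.

(** The integral of a nonnegative function is the supremum of the integrals of
    the simple functions below it. A simple function below g, set to 0 on the
    exceptional null set and divided by K, lies below f. This form of the
    comparison applies to the norm of f - s_n in the definition of the Bochner
    integral, which may fail to be Borel measurable. *)
Lemma ae_ge0_le_integralZ d (T : measurableType d) (R : realType)
    (mu : {measure set T -> \bar R}) (D : set T) (f g : T -> \bar R) (K : R) :
  (0 < K)%R ->
  (forall x, D x -> 0 <= f x) -> (forall x, D x -> 0 <= g x) ->
  {ae mu, forall x, D x -> g x <= K%:E * f x} ->
  \int[mu]_(x in D) g x <= K%:E * \int[mu]_(x in D) f x.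
Proof.
move=> K0 f0 g0 [N [mN N0 gf]]; rewrite [leLHS]integral_mkcond.
have gD0 x : 0 <= (g \_ D) x.
  by rewrite /patch; case: ifPn => //; rewrite inE; exact: g0.
have fD0 x : 0 <= (f \_ D) x.
  by rewrite /patch; case: ifPn => //; rewrite inE; exact: f0.
rewrite ge0_integralTE//; apply: ge_ereal_sup => _ [h /= hg <-].
have K1 : (0 <= K^-1)%R by rewrite invr_ge0 ltW.
pose h' := proj_nnsfun h (measurableC mN).
have h'E x : h' x = if x \in N then 0%R else h x.
  rewrite /h' /= mindicE in_setC; case: (x \in N) => /=.
    by rewrite mulr0.
  by rewrite mulr1.
have -> : sintegral mu h = sintegral mu h'.
  rewrite -!integralT_nnsfun; apply: ae_eq_integral => //.
  - by apply/measurable_EFinP.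
  - by apply/measurable_EFinP.
  exists N; split => // x /= /not_implyP[_] hh'; apply: contrapT => Nx.
  have := h'E x; rewrite memNset// => hE.
  exact: (hh' (congr1 EFin (esym hE))).
rewrite -lee_pdivrMl// -sintegralrM.
rewrite -[X in X <= _](_ : sintegral mu (scale_nnsfun h' K1) = _)//.
rewrite integral_mkcond ge0_integralTE//.
apply: ereal_sup_ubound; exists (scale_nnsfun h' K1) => //= x.
change ((K^-1 * h' x)%:E <= (f \_ D) x); rewrite h'E.
case: ifPn => xN; first by rewrite mulr0.
have := hg x; rewrite /patch; case: ifPn; rewrite ?inE => Dx hx.
  rewrite EFinM lee_pdivrMl//; apply: le_trans hx _; apply: contrapT => nle.
  move: xN; rewrite notin_setE; apply; apply: gf => /= H; exact/nle/H.
by rewrite lee_fin mulr_ge0_le0.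
Qed.

End IntegralMonotone.

Lemma bounded_integrable d (T : measurableType d) (R : realType)
    (mu : {measure set T -> \bar R}) (D : set T) (f : T -> R) (M : R) :
  measurable D -> (mu D < +oo)%E -> measurable_fun D f ->
  (forall t, D t -> `|f t| <= M) -> mu.-integrable D (EFin \o f).
Proof.
move=> mD Dfin mf fM; apply: measurable_bounded_integrable => //.
exists M; split=> [|y My t Dt]; first exact: num_real.
exact: le_trans (fM _ Dt) (ltW My).
Qed.

Section Bochner.
Variables (R : realType) (V : normedModType R[i]).
Local Notation mu := (@lebesgue_measure R).

(** A functional with complex values is treated through its real and imaginary
    parts, which are linear over the reals only. *)
Definition real_linear (r : V -> R) : Prop :=
  (forall u v, r (u + v) = r u + r v) /\
  (forall (a : R) v, r (a%:C *: v) = a * r v).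

Lemma real_linear0 r : real_linear r -> r 0 = 0.
Proof. by move=> [_ rZ]; rewrite -(scale0r 0) (rZ 0) mul0r. Qed.

Lemma real_linearB r u v : real_linear r -> r (u - v) = r u - r v.
Proof.
move=> [rD rZ]; rewrite rD -scaleN1r (_ : -1 = (-1)%:C); last by rewrite (realcN 1).
by rewrite rZ mulN1r.
Qed.

Variables (D : set (measurableTypeR R)) (mD : measurable D) (Dfin : (mu D < +oo)%E).

(** On D the function r o s is the sum over the values v of s of r(v) times the
    indicator of the set where s takes the value v. *)
Lemma real_linear_simple (r : V -> R) (s : {fimfun R >-> V}) : real_linear r ->
  is_simple D s ->
  mu.-integrable D (EFin \o (r \o s)) /\
  r (simple_integral D s) = \int[mu]_(t in D) r (s t).
Proof.
move=> rl ss.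
pose I : seq V := finmap.enum_fset (fset_set (range s)).
pose A v := D `&` s @^-1` [set v].
pose F (v : V) (t : R) := ((r v)%:E * (\1_(A v) t)%:E)%E.
have mA v : @measurable _ (measurableTypeR R) (A v) by have [] := ss v.
have Afin v : (mu (A v) < +oo)%E.
  by apply: le_lt_trans Dfin; apply: le_measure; rewrite ?inE//; exact: subIsetl.
have intA v : mu.-integrable D (EFin \o \1_(A v)).
  apply: (bounded_integrable (M := 1)) => //.
  by move=> t _; rewrite indicE; case: (_ \in _); rewrite ?normr1 ?normr0.
have intF v : mu.-integrable D (F v) .
  exact: (integrableZl mD (r v) (intA v)).
have rs t : D t -> (r (s t))%:E = (\sum_(v <- I) F v t)%E.
  move=> Dt.
  have sI : s t \in I by rewrite in_fset_set// inE; exists t.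
  rewrite (bigD1_seq (s t))//=; last exact: finmap.fset_uniq.
  rewrite /F indicE mem_set; last by split.
  rewrite mule1 big1 ?adde0// => v vs.
  rewrite indicE memNset ?mule0// => -[_ /= svt].
  by rewrite svt eqxx in vs.
have rsE : {in D, (fun t => (\sum_(v <- I) F v t)%E) =1 EFin \o (r \o s)}.
  by move=> t; rewrite inE => Dt; exact/esym/rs.
split.
  apply: (eq_integrable mD _ _ rsE).
  exact: (integrable_sum mD I (fun v _ => intF v)).
rewrite /simple_integral fsbig_finite//= (big_morph r rl.1 (real_linear0 rl)).
rewrite /Rintegral.
have -> : (\int[mu]_(t in D) (r (s t))%:E =
    \int[mu]_(t in D) \sum_(v <- I) F v t)%E.
  by apply: eq_integral => t; rewrite inE => Dt; exact: rs.
rewrite integral_sum//.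
have E v : (\int[mu]_(t in D) F v t)%E = (fine (mu (A v)) * r v)%:E.
  have Iv : (\int[mu]_(t in D) (\1_(A v) t)%:E = mu (A v))%E.
    have := @integral_indic _ _ _ mu D mD (A v) (mA v).
    by rewrite {2}/A setIC setIA setIid.
  have := @integralZl _ _ _ mu D mD _ (intA v) (r v).
  rewrite /F => -> /=; rewrite Iv muleC EFinM fineK// ge0_fin_numE//.
rewrite (eq_bigr (fun v => (fine (mu (A v)) * r v)%:E)); last first.
  by move=> v _; exact: E.
rewrite sumEFin /=; apply: eq_bigr => v _; exact: rl.2.
Qed.

(** Compare both sides with r applied to a simple function s_n: the left side
    differs from it by at most K |v - int s_n|, the right side by at most
    K int |f - s_n|. The function g is only almost everywhere equal to r o f
    because a control is known only up to null sets. *)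
Lemma Bochner_real_linear (r : V -> R) (K : R) (f : R -> V) (g : R -> R) (v : V) :
  real_linear r -> (forall u, `|r u| <= K * rnorm u) ->
  is_Bochner_integral D f v ->
  {ae mu, forall t, D t -> r (f t) = g t} ->
  mu.-integrable D (EFin \o g) ->
  r v = \int[mu]_(t in D) g t.
Proof.
move=> rl rK [s [ss _ sf sv]] rfg intg.
pose K' := `|K| + 1; have K'0 : 0 < K' by rewrite ltr_wpDl.
have rK' u : `|r u| <= K' * rnorm u.
  rewrite (le_trans (rK _))// ler_wpM2r ?rnorm_ge0//.
  by rewrite (le_trans (ler_norm _))// lerDl.
apply/eqP; rewrite -subr_eq0 -normr_eq0 eq_le normr_ge0 andbT.
apply/ler_addgt0Pr => e e0; rewrite add0r.
have eK : 0 < e / 2 / K' by rewrite !divr_gt0.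
have /cvg_rnormP/(_ _ eK) near1 := sv.
have near2 : \forall n \near \oo,
    ((\int[mu]_(t in D) (rnorm (f t - s n t))%:E) < (e / 2 / K')%:E)%E.
  have := sf [set x | (x < (e / 2 / K')%:E)%E]; apply.
  exact: (@nbhs_open_ereal_lt _ 0 (fun=> e / 2 / K')).
have [n [n1 n2]] : exists n, rnorm (v - simple_integral D (s n)) < e / 2 / K' /\
    ((\int[mu]_(t in D) (rnorm (f t - s n t))%:E) < (e / 2 / K')%:E)%E.
  by have := filter_ex (filterI near1 near2); case=> n [? ?]; exists n.
have [ints rs] := real_linear_simple rl (ss n).
rewrite (splitr e) -(subrK (r (simple_integral D (s n))) (r v)) -addrA.
rewrite (le_trans (ler_normD _ _))// lerD//.
  rewrite -real_linearB// (le_trans (rK' _))// -ler_pdivlMl// mulrC; exact: ltW.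
rewrite rs distrC -RintegralB//.
have intB : mu.-integrable D (EFin \o (fun t => g t - r (s n t))).
  exact: (integrableB mD intg ints).
rewrite -lee_fin EFin_normr_Rintegral//.
rewrite (le_trans (le_abse_integral _ _ _))//; first by case/integrableP: intB.
have := @ae_ge0_le_integralZ _ _ _ mu D (fun t => (rnorm (f t - s n t))%:E)
  (fun t => `|(g t - r (s n t))%:E|%E) K' K'0.
move=> /(_ _ _ _)/le_trans; apply.
- by move=> t _; rewrite lee_fin rnorm_ge0.
- by move=> t _; rewrite abse_ge0.
- move: rfg; apply: ae_lebesgueS => t rt Dt /=.
  by rewrite -(rt Dt) -real_linearB// lee_fin.
- rewrite -lee_pdivlMl// -EFinM mulrC; exact: ltW.
Qed.

End Bochner.

Section BochnerLinear.
Variables (R : realType) (V : completeNormedModType R[i]).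
Variable dot : {dot V for Num.conj}.
Hypothesis hdot : inner_product_norm dot.
Local Notation mu := (@lebesgue_measure R).

Lemma real_linear_Re_dot (w : V) : real_linear (fun v : V => complex.Re (dot v w)).
Proof.
split=> [u v|a v]; first by rewrite linearDl raddfD.
rewrite linearZl_LR /=; move: (dot v w) => [x y] /=.
by rewrite mul0r subr0.
Qed.

(** If s_n are simple functions for f, then L o s_n, extended by 0 from D to
    D', are simple functions for f'. *)
Lemma Bochner_linear (L : {linear V -> V}) (D D' : set (measurableTypeR R))
    (f f' : R -> V) (v : V) :
  continuous L -> measurable D -> measurable D' -> D `<=` D' ->
  (mu D' < +oo)%E ->
  (forall t, D t -> f' t = L (f t)) ->
  (forall t, D' t -> ~ D t -> f' t = 0) ->
  is_Bochner_integral D f v -> is_Bochner_integral D' f' (L v).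
Proof.
move=> Lc mD mD' DD' D'fin f'D f'0 [s [ss sae sint slim]].
have Dfin : (mu D < +oo)%E.
  by apply: le_lt_trans D'fin; apply: le_measure; rewrite ?inE.
pose g n (t : R) : V := if t \in D then L (s n t) else 0.
have gfin n : finite_set (range (g n)).
  apply: (@sub_finite_set _ _ ((L @` range (s n)) `|` [set 0])); last first.
    by rewrite finite_setU; split => //; apply: finite_image.
  move=> _ [t _ <-]; rewrite /g; case: ifP => _; last by right.
  by left; exists (s n t) => //; exists t.
pose s' n : {fimfun R >-> V} := fimfun_Sub (mem_set (gfin n)).
have s'E n : s' n = g n :> (R -> V) by exact: fimfun_valP.
have [K K0 LK] := linear_rnorm_bounded Lc.
have s's n : is_simple D' (s' n).
  move=> w; suff mw : @measurable _ (measurableTypeR R) (D' `&` s' n @^-1` [set w]).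
    split=> // _; apply: le_lt_trans D'fin; apply: le_measure; rewrite ?inE//.
  have mDw : @measurable _ (measurableTypeR R) (D `&` (fun t => L (s n t)) @^-1` [set w]).
    have -> : D `&` (fun t => L (s n t)) @^-1` [set w] =
      \bigcup_(u in range (s n) `&` L @^-1` [set w]) (D `&` s n @^-1` [set u]).
      apply/seteqP; split=> [t [Dt /= Lt]|t [u [_ /= Lu] [Dt /= su]]].
        by exists (s n t) => //; split=> //; exists t.
      by split=> //=; rewrite su.
    apply: (@fin_bigcup_measurable _ (measurableTypeR R)).
      exact: finite_setIl.
    by move=> u _; have [] := ss n u.
  rewrite s'E; have [w0|w0] := eqVneq w 0.
    rewrite (_ : _ `&` _ = (D `&` (fun t => L (s n t)) @^-1` [set w]) `|` (D' `\` D)).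
      by apply: measurableU => //; exact: measurableD.
    apply/seteqP; split=> [t [D't /=]|t [[Dt /= Lt]|[D't Dt]]].
    - rewrite /g; case: ifPn; rewrite ?inE => Dt Lt; first by left.
      by right; split => //; move: Dt; rewrite notin_setE.
    - by split; [exact: DD'|rewrite /= /g mem_set].
    - by split => //=; rewrite /g memNset.
  rewrite (_ : _ `&` _ = D `&` (fun t => L (s n t)) @^-1` [set w])//.
  apply/seteqP; split=> [t [D't /=]|t [Dt /= Lt]].
  - rewrite /g; case: ifPn; rewrite ?inE => // Dt Lt.
    by rewrite -Lt eqxx in w0.
  - by split; [exact: DD'|rewrite /= /g mem_set].
(* Both integrals are sums over the values of a function, and L may merge
   values of s n. They are compared through the functional Re (., u), u their
   difference, for which both become the same Lebesgue integral. *)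
have simpleE n : simple_integral D' (s' n) = L (simple_integral D (s n)).
  apply/eqP; rewrite -subr_eq0; apply/eqP.
  set u := _ - _.
  have rl := real_linear_Re_dot u.
  suff : complex.Re (dot u u) = 0.
    rewrite (dotrnorm hdot) /= => /eqP; rewrite sqrf_eq0 => /eqP; exact: rnorm0_eq0.
  rewrite {1}/u (real_linearB _ _ rl).
  have rlL : real_linear (fun v => complex.Re (dot (L v) u)).
    split=> [x y|a x]; first by rewrite (linearD L); exact: (rl.1 (L x) (L y)).
    by rewrite (_ : L (a%:C *: x) = a%:C *: L x);
      [exact: (rl.2 a (L x))|exact: linearZ].
  have [_ ->] := real_linear_simple mD' D'fin rl (s's n).
  have [_ ->] := real_linear_simple mD Dfin rlL (ss n).
  apply/eqP; rewrite subr_eq0; apply/eqP.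
  rewrite /Rintegral; congr fine.
  rewrite integral_mkcond [RHS]integral_mkcond; apply: eq_integral => t _.
  rewrite /patch s'E /g; case: ifPn => tD'; case: ifPn => tD //.
    by rewrite linear0l.
  by move: tD'; rewrite notin_setE => D't; case: D't; exact/DD'/set_mem.
exists s'; split => //.
- move: sae; apply: ae_lebesgueS => t st D't; have [Dt|Dt] := pselect (D t).
    rewrite f'D//; have : L (s n t) @[n --> \oo] --> L (f t).
      by apply: (cvg_comp _ _ (st Dt)); exact: Lc.
    by under [X in _ -> X @ _ --> _]eq_fun do rewrite s'E /g mem_set//.
  rewrite f'0//; under eq_fun do rewrite s'E /g memNset//.
  exact: cvg_cst.
- have ub n : (\int[mu]_(t in D') (rnorm (f' t - s' n t))%:E <=
      K%:E * \int[mu]_(t in D) (rnorm (f t - s n t))%:E)%E.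
    rewrite integral_mkcond [in leRHS]integral_mkcond.
    apply: ae_ge0_le_integralZ => //.
    + by move=> t _; rewrite /patch; case: ifP => _ //; rewrite lee_fin rnorm_ge0.
    + by move=> t _; rewrite /patch; case: ifP => _ //; rewrite lee_fin rnorm_ge0.
    apply: aeW => t _; rewrite /patch s'E /g; case: ifPn => [/set_mem D't|tD'].
      case: ifPn => [/set_mem Dt|/negP tD].
        by rewrite f'D// -linearB lee_fin LK.
      by rewrite f'0// ?subrr ?rnorm0 ?mule0// => Dt; apply: tD; exact: mem_set.
    case: ifPn => tD; last by rewrite mule0.
    by rewrite mule_ge0 ?lee_fin ?rnorm_ge0// ltW.
  apply: (@squeeze_cvge _ _ _ _ (cst 0%E) _
    (fun n => K%:E * \int[mu]_(t in D) (rnorm (f t - s n t))%:E)%E).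
  + apply: nearW => n; rewrite ub andbT.
    by apply: integral_ge0 => t _; rewrite lee_fin rnorm_ge0.
  + exact: cvg_cst.
  + by rewrite -[X in _ --> X](mule0 K%:E); apply: cvgeZl.
- under eq_fun do rewrite simpleE.
  by apply: (cvg_comp _ _ slim); exact: Lc.
Qed.

End BochnerLinear.

(** * Gram matrices and strong minimality *)

Section Gram.
Local Open Scope sesquilinear_scope.
Variable R : realType.
Local Notation C := (R[i]).

Lemma row_mulmx_conj n (u v : 'rV[C]_n) :
  (u *m v ^t*) 0 0 = \sum_i u 0 i * Num.conj (v 0 i).
Proof. by rewrite mxE; apply: eq_bigr => i _; rewrite !mxE. Qed.

(** By the spectral theorem the Hermitian form is a combination of the |w_i|^2,
    with the eigenvalues as coefficients, where w is v in an orthonormal basis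
    of eigenvectors. *)
Lemma hermitian_min_eigenvalue n (G : 'M[C]_n) (g : R) (v : 'rV[C]_n) :
  (forall i j, G i j = Num.conj (G j i)) ->
  (forall a : C, eigenvalue G a -> g%:C <= a) ->
  g%:C * \sum_i (v 0 i * Num.conj (v 0 i)) <=
  \sum_i \sum_j v 0 i * G i j * Num.conj (v 0 j).
Proof.
move=> Gh gmin.
have /hermitian_normalmx/orthomx_spectralP GE : G \is hermsymmx.
  apply/is_hermitianmxP; rewrite expr0 scale1r; apply/matrixP => i j.
  by rewrite !mxE.
have Pu := spectral_unitarymx G.
move: GE; rewrite invmx_unitary//.
set P := spectralmx G in Pu *; set D := spectral_diag G => GE.
pose w := v *m P ^t*.
have PP : P *m P ^t* = 1%:M by apply/unitarymxP.
have PP' : P ^t* *m P = 1%:M by apply: mulmx1C.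
have wE : w *m P = v by rewrite /w -mulmxA PP' mulmx1.
have -> : \sum_i (v 0 i * Num.conj (v 0 i)) = \sum_i (w 0 i * Num.conj (w 0 i)).
  rewrite -!row_mulmx_conj; congr (_ 0 0).
  by rewrite /w trmx_mul map_mxM trmxCK mulmxA -[v *m _ *m P]mulmxA PP' mulmx1.
have -> : \sum_i \sum_j v 0 i * G i j * Num.conj (v 0 j) =
    \sum_i (D 0 i * (w 0 i * Num.conj (w 0 i))).
  transitivity ((v *m G *m v ^t*) 0 0).
    rewrite row_mulmx_conj exchange_big; apply: eq_bigr => j _.
    by rewrite !mxE mulr_suml.
  transitivity ((w *m diag_mx D *m w ^t*) 0 0).
    by congr (_ 0 0); rewrite GE /w trmx_mul map_mxM trmxCK !mulmxA.
  rewrite row_mulmx_conj; apply: eq_bigr => i _.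
  by rewrite mul_mx_diag !mxE -mulrA mulrCA.
rewrite mulr_sumr; apply: ler_sum => i _; apply: ler_wpM2r.
  exact: mul_conjC_ge0.
apply: gmin; apply/eigenvalueP; exists (row i P).
  rewrite -row_mul GE !mulmxA PP mul1mx row_mul row_diag_mx -scalemxAl -rowE//.
apply/eqP => ri0; have : row i (P *m P ^t*) 0 i = 0.
  by rewrite row_mul ri0 mul0mx mxE.
by rewrite PP !mxE eqxx => /eqP; rewrite oner_eq0.
Qed.

End Gram.

Section StronglyMinimal.
Variables (R : realType) (E : lmodType R[i]) (ip : E -> E -> R[i]).
Variable x : nat -> E.
Hypothesis ipC : forall i j, ip (x i) (x j) = Num.conj (ip (x j) (x i)).

(** The squared norm, with respect to ip, of sum a_i x_i. *)
Definition gram_form n (a : nat -> R[i]) : R :=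
  complex.Re (\sum_(i < n) \sum_(j < n) a i * Num.conj (a j) * ip (x i) (x j)).

(** For a padded by zeros to length N + 1 >= n neither side changes, and the
    bound holds with the least eigenvalue of the Gram matrix of order N + 1 in
    place of l. Let N tend to infinity. *)
Lemma strongly_minimal_bound : strongly_minimal_seq ip x ->
  exists2 l : R, 0 < l & forall n (a : nat -> R[i]),
    l * \sum_(i < n) complex.Re `|a i : R[i]| ^+ 2 <= gram_form n a.
Proof.
move=> [gam [l [gmin gl l0]]]; exists l => // n a.
have gamP N (b : nat -> R[i]) : gam N * \sum_(i < N.+1) complex.Re `|b i| ^+ 2 <= gram_form N.+1 b.
  have [_ Gmin] := gmin N.
  have Gh i j : gram ip x N.+1 i j = Num.conj (gram ip x N.+1 j i).
    by rewrite !mxE ipC.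
  have := hermitian_min_eigenvalue (\row_i b i) Gh Gmin.
  under eq_bigr do rewrite mxE -Re_norm_conj.
  rewrite -realc_sum -realcM lecE => /andP[_] /=.
  rewrite /gram_form; congr (_ <= complex.Re _).
  by apply: eq_bigr => i _; apply: eq_bigr => j _; rewrite !mxE mulrAC.
rewrite leNgt; apply/negP => lt.
pose S := \sum_(i < n) complex.Re `|a i| ^+ 2.
have : gam N * S @[N --> \oo] --> l * S by apply: cvgMr_tmp.
move/cvgr_gt/(_ _ lt) => near1.
have near2 : \forall N \near \oo, (n <= N)%N by exists n.
have [N [N1 N2]] := filter_ex (filterI near1 near2).
have nN : (n <= N.+1)%N by exact: leqW.
pose b i := if (i < n)%N then a i else 0.
have := gamP N b; apply/negP; rewrite -ltNge.
have -> : \sum_(i < N.+1) complex.Re `|b i| ^+ 2 = S.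
  rewrite /S (big_ord_widen _ (fun i => complex.Re `|a i| ^+ 2) nN).
  rewrite [RHS]big_mkcond; apply: eq_bigr => i _; rewrite /b.
  by case: ifP => // _; rewrite normr0 expr0n.
suff -> : gram_form N.+1 b = gram_form n a by [].
rewrite /gram_form; congr complex.Re.
rewrite [RHS](big_ord_widen _ (fun i => \sum_(j < n) a i * Num.conj (a j) * ip (x i) (x j)) nN).
rewrite [RHS]big_mkcond; apply: eq_bigr => i _; rewrite /b.
case: ifP => // _; last by rewrite big1// => j _; rewrite !mul0r.
rewrite [RHS](big_ord_widen _ (fun j => a i * Num.conj (a j) * ip (x i) (x j)) nN).
rewrite [RHS]big_mkcond; apply: eq_bigr => j _.
by case: ifP => // _; rewrite rmorph0 mulr0 mul0r.
Qed.

(** A vector in the kernel of the Gram matrix has gram_form 0, hence is 0 by the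
    lower bound; so the matrix is invertible. *)
Lemma gram_solve : strongly_minimal_seq ip x ->
  forall n (c : nat -> R[i]), exists a : nat -> R[i],
  forall i, (i < n)%N -> \sum_(j < n) Num.conj (a j) * ip (x i) (x j) = c i.
Proof.
move=> /strongly_minimal_bound[l l0 lb] n c.
have Gu : gram ip x n \in unitmx.
  rewrite -row_free_unit; apply: inj_row_free => v vG.
  pose a i := if insub i is Some k then v 0 k else 0.
  have aE (k : 'I_n) : a k = v 0 k by rewrite /a valK.
  have g0 : gram_form n a = 0.
    rewrite /gram_form exchange_big big1//= => j _.
    rewrite (eq_bigr (fun i : 'I_n => Num.conj (a j) * (v 0 i * gram ip x n i j))).
      have := congr1 (fun M : 'rV[R[i]]_n => M 0 j) vG; rewrite !mxE -mulr_sumr => ->.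
      by rewrite mulr0.
    by move=> i _; rewrite !aE mxE mulrAC mulrC.
  have s0 : \sum_(i < n) complex.Re `|a i| ^+ 2 = 0.
    apply/le_anti; rewrite sumr_ge0 ?andbT; last by move=> i _; exact: sqr_ge0.
    by rewrite -(@pmulr_rle0 _ l)// (le_trans (lb _ _))// g0.
  apply/rowP => k; rewrite mxE -aE; apply: Re_norm_eq0; apply/eqP.
  rewrite -sqrf_eq0; move/eqP: s0; rewrite psumr_eq0; last first.
    by move=> i _; exact: sqr_ge0.
  by move/allP/(_ k (mem_index_enum _)).
pose y := invmx (gram ip x n) *m \col_i c i.
exists (fun j => if insub j is Some k then Num.conj (y k 0) else 0) => i iltn.
have := congr1 (fun M : 'cV[R[i]]_n => M (Ordinal iltn) 0) (mulKVmx Gu (\col_i c i)).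
rewrite !mxE /= => <-; apply: eq_bigr => j _.
by rewrite valK conjCK !mxE mulrC.
Qed.

End StronglyMinimal.

(** * Square integrable complex functions *)

Section ComplexIntegral.
Variable R : realType.
Local Notation mu := (@lebesgue_measure R).
Local Notation RT := (measurableTypeR R).
Variables (D : set RT) (mD : measurable D).
Implicit Types (f g u v : R -> R[i]).

Definition cintegrable f : Prop :=
  mu.-integrable D (EFin \o (fun t => complex.Re (f t))) /\
  mu.-integrable D (EFin \o (fun t => complex.Im (f t))).

Lemma cReD (z w : R[i]) : complex.Re (z + w) = complex.Re z + complex.Re w.
Proof. by case: z w => [a b] [c d]. Qed.
Lemma cImD (z w : R[i]) : complex.Im (z + w) = complex.Im z + complex.Im w.
Proof. by case: z w => [a b] [c d]. Qed.
Lemma cReM (z w : R[i]) : complex.Re (z * w) =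
  complex.Re z * complex.Re w - complex.Im z * complex.Im w.
Proof. by case: z w => [a b] [c d]. Qed.
Lemma cImM (z w : R[i]) : complex.Im (z * w) =
  complex.Re z * complex.Im w + complex.Im z * complex.Re w.
Proof. by case: z w => [a b] [c d]. Qed.
Lemma cReJ (z : R[i]) : complex.Re (Num.conj z) = complex.Re z.
Proof. by case: z. Qed.
Lemma cImJ (z : R[i]) : complex.Im (Num.conj z) = - complex.Im z.
Proof. by case: z. Qed.
Lemma Re_le_norm (z : R[i]) : `|complex.Re z| <= complex.Re `|z|.
Proof. by rewrite -lecR Re_normK normc_ge_Re. Qed.
Lemma Im_le_norm (z : R[i]) : `|complex.Im z| <= complex.Re `|z|.
Proof.
rewrite -ler_sqr ?nnegrE ?Re_norm_ge0// real_normK ?num_real//.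
by rewrite Re_norm_sqr lerDr sqr_ge0.
Qed.

Lemma eq_cintegral f g : (forall t, D t -> f t = g t) ->
  cintegral D f = cintegral D g.
Proof.
move=> fg; rewrite /cintegral.
by congr (_ +i* _); apply: eq_Rintegral => t; rewrite inE => /fg ->.
Qed.

Lemma cintegrableD f g : cintegrable f -> cintegrable g ->
  cintegrable (fun t => f t + g t).
Proof.
move=> [f1 f2] [g1 g2]; split.
  by apply: (eq_integrable mD _ _ _ (integrableD mD f1 g1)) => t _ /=; rewrite cReD EFinD.
by apply: (eq_integrable mD _ _ _ (integrableD mD f2 g2)) => t _ /=; rewrite cImD EFinD.
Qed.

Lemma cintegralD f g : cintegrable f -> cintegrable g ->
  cintegral D (fun t => f t + g t) = cintegral D f + cintegral D g.
Proof.
move=> [f1 f2] [g1 g2]; rewrite /cintegral; apply/eqP; rewrite eq_complex /=.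
apply/andP; split; apply/eqP.
  rewrite -(RintegralD mD f1 g1); apply: eq_Rintegral => t _; exact: cReD.
rewrite -(RintegralD mD f2 g2); apply: eq_Rintegral => t _; exact: cImD.
Qed.

Lemma cintegrableZ (c : R[i]) f : cintegrable f -> cintegrable (fun t => c * f t).
Proof.
move=> [f1 f2]; split.
  have := integrableB mD (integrableZl mD (complex.Re c) f1)
    (integrableZl mD (complex.Im c) f2).
  by apply: (eq_integrable mD) => t _ /=; rewrite cReM.
have := integrableD mD (integrableZl mD (complex.Re c) f2)
  (integrableZl mD (complex.Im c) f1).
by apply: (eq_integrable mD) => t _ /=; rewrite cImM.
Qed.

Lemma cintegralZ (c : R[i]) f : cintegrable f ->
  cintegral D (fun t => c * f t) = c * cintegral D f.
Proof.
move=> [f1 f2]; rewrite /cintegral; apply/eqP; rewrite eq_complex cReM cImM /=.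
have Z (a : R) (h : R -> R) : mu.-integrable D (EFin \o h) ->
    mu.-integrable D (EFin \o (fun t => a * h t)).
  by move=> hi; exact: (integrableZl mD a hi).
rewrite -(RintegralZl _ mD f1) -(RintegralZl _ mD f2).
rewrite -(RintegralZl _ mD f2) -(RintegralZl _ mD f1).
rewrite -RintegralB//; [|exact: Z|exact: Z].
rewrite -RintegralD//; [|exact: Z|exact: Z].
by apply/andP; split; apply/eqP; apply: eq_Rintegral => t _; rewrite ?cReM ?cImM.
Qed.

Lemma cintegrable0 : cintegrable (fun=> 0).
Proof. by split; exact: integrable0. Qed.

Lemma cintegral0 : cintegral D (fun=> 0) = 0.
Proof.
rewrite /cintegral /=; apply/eqP; rewrite eq_complex /= /Rintegral.
by rewrite integral0 /= eqxx.
Qed.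

Lemma cintegral_sum (I : Type) (r : seq I) (P : pred I) (F : I -> R -> R[i]) :
  (forall i, P i -> cintegrable (F i)) ->
  cintegrable (fun t => \sum_(i <- r | P i) F i t) /\
  cintegral D (fun t => \sum_(i <- r | P i) F i t) =
  \sum_(i <- r | P i) cintegral D (F i).
Proof.
move=> Fi; elim: r => [|i r [IH1 IH2]].
  rewrite big_nil (_ : (fun _ => _) = fun=> 0); last first.
    by apply/funext => t; rewrite big_nil.
  by split; [exact: cintegrable0|exact: cintegral0].
rewrite big_cons.
case: (boolP (P i)) => Pi.
  rewrite (_ : (fun _ => _) = fun t => F i t + \sum_(j <- r | P j) F j t); last first.
    by apply/funext => t; rewrite big_cons Pi.
  by split; [apply: cintegrableD => //; exact: Fi|rewrite cintegralD ?IH2//; exact: Fi].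
rewrite (_ : (fun _ => _) = fun t => \sum_(j <- r | P j) F j t)//.
by apply/funext => t; rewrite big_cons (negbTE Pi).
Qed.

(** The finiteness of the integral of |u|^2 as an integrability, to which the
    algebra and comparison of integrable functions apply. *)
Lemma L2P u : L2 D u <->
  [/\ measurable_fun D (fun t => complex.Re (u t)),
      measurable_fun D (fun t => complex.Im (u t)) &
      mu.-integrable D (EFin \o (fun t => complex.Re `|u t| ^+ 2))].
Proof.
split=> [[u1 u2 u3]|[u1 u2 /integrableP[_ u3]]]; split => //; last first.
  rewrite (le_lt_trans _ u3)// le_eqVlt; apply/orP; left; apply/eqP.
  by apply: eq_integral => t _ /=; rewrite ger0_norm ?sqr_ge0.
apply/integrableP; split.
  apply/measurable_EFinP; rewrite (_ : (fun t => _) =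
      (fun t => complex.Re (u t) ^+ 2 + complex.Im (u t) ^+ 2)).
    by apply: measurable_funD; exact: measurable_funX.
  by apply/funext => t; rewrite Re_norm_sqr.
rewrite (le_lt_trans _ u3)// le_eqVlt; apply/orP; left; apply/eqP.
by apply: eq_integral => t _ /=; rewrite ger0_norm ?sqr_ge0.
Qed.

Lemma L2_cintegrableM u v : L2 D u -> L2 D v -> cintegrable (fun t => u t * v t).
Proof.
move=> /L2P[u1 u2 u3] /L2P[v1 v2 v3].
have uv := integrableD mD u3 v3.
have bd t : complex.Re `|u t * v t| <= complex.Re `|u t| ^+ 2 + complex.Re `|v t| ^+ 2.
  rewrite Re_normM; have := sqr_ge0 (complex.Re `|u t| - complex.Re `|v t|).
  have := Re_norm_ge0 (u t); have := Re_norm_ge0 (v t).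
  by move: (complex.Re `|u t|) (complex.Re `|v t|) => a b; nra.
have bd0 t : 0 <= complex.Re `|u t| ^+ 2 + complex.Re `|v t| ^+ 2.
  by rewrite addr_ge0 ?sqr_ge0.
have bdn (a : R) t : `|a| <= complex.Re `|u t * v t| ->
    `|a| <= `|complex.Re `|u t| ^+ 2 + complex.Re `|v t| ^+ 2|.
  by move=> at_le; rewrite [leRHS]ger0_norm// (le_trans at_le).
split; apply: (le_integrable mD _ _ uv).
- apply/measurable_EFinP.
  rewrite (_ : (fun t => _) = (fun t => complex.Re (u t) * complex.Re (v t)
    - complex.Im (u t) * complex.Im (v t))); last by apply/funext => t; rewrite cReM.
  by apply: measurable_funB; exact: measurable_funM.
- move=> t _; rewrite /= lee_fin; exact: bdn (Re_le_norm _).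
- apply/measurable_EFinP.
  rewrite (_ : (fun t => _) = (fun t => complex.Re (u t) * complex.Im (v t)
    + complex.Im (u t) * complex.Re (v t))); last by apply/funext => t; rewrite cImM.
  by apply: measurable_funD; exact: measurable_funM.
- move=> t _; rewrite /= lee_fin; exact: bdn (Im_le_norm _).
Qed.

Lemma L2_conj u : L2 D u -> L2 D (fun t => Num.conj (u t)).
Proof.
move=> [u1 u2 u3]; split.
- by under eq_fun do rewrite cReJ.
- by under eq_fun do rewrite cImJ; exact: measurable_funN.
- by under eq_integral do rewrite Re_norm_conjE.
Qed.

Lemma L2Z (c : R[i]) u : L2 D u -> L2 D (fun t => c * u t).
Proof.
move=> /L2P[u1 u2 u3]; apply/L2P; split.
- under eq_fun do rewrite cReM.
  by apply: measurable_funB; apply: measurable_funM.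
- under eq_fun do rewrite cImM.
  by apply: measurable_funD; apply: measurable_funM.
- have := integrableZl mD (complex.Re `|c| ^+ 2) u3.
  apply: (eq_integrable mD) => t _.
  transitivity (complex.Re `|c| ^+ 2 * complex.Re `|u t| ^+ 2)%:E => //.
  by rewrite -exprMn -Re_normM.
Qed.

Lemma L2D u v : L2 D u -> L2 D v -> L2 D (fun t => u t + v t).
Proof.
move=> /L2P[u1 u2 u3] /L2P[v1 v2 v3]; apply/L2P.
have m1 : measurable_fun D (fun t => complex.Re (u t + v t)).
  by under eq_fun do rewrite cReD; exact: measurable_funD.
have m2 : measurable_fun D (fun t => complex.Im (u t + v t)).
  by under eq_fun do rewrite cImD; exact: measurable_funD.
split => //.
have uv := integrableZl mD 2 (integrableD mD u3 v3).
apply: (le_integrable mD _ _ uv).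
  apply/measurable_EFinP; under eq_fun do rewrite Re_norm_sqr.
  by apply: measurable_funD; exact: measurable_funX.
suff bd t : `|complex.Re `|u t + v t| ^+ 2| <=
    `|2 * (complex.Re `|u t| ^+ 2 + complex.Re `|v t| ^+ 2)|.
  by move=> t _; rewrite /= lee_fin; exact: bd.
have p0 : 0 <= 2 * (complex.Re `|u t| ^+ 2 + complex.Re `|v t| ^+ 2).
  by rewrite mulr_ge0// addr_ge0// sqr_ge0.
rewrite [leLHS]ger0_norm ?sqr_ge0// [leRHS]ger0_norm// {p0}.
have := Re_normD (u t) (v t); have := Re_norm_ge0 (u t + v t).
move: (complex.Re `|u t + v t|) (complex.Re `|u t|) (complex.Re `|v t|) => c a b c0 cab.
have := sqr_ge0 (a - b).
have : c ^+ 2 <= (a + b) ^+ 2 by rewrite ler_sqr// nnegrE// (le_trans c0).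
by nra.
Qed.

Lemma L2_sum (I : Type) (r : seq I) (P : pred I) (F : I -> R -> R[i]) :
  (forall i, P i -> L2 D (F i)) -> L2 D (fun t => \sum_(i <- r | P i) F i t).
Proof.
move=> FL; elim: r => [|i r IH].
  under eq_fun do rewrite big_nil.
  have L0 : L2 D (fun=> 0 : R[i]).
    split; [exact: measurable_cst|exact: measurable_cst|].
    by rewrite integral0_eq ?ltry// => t _; rewrite normr0 expr0n.
  exact: L0.
under eq_fun do rewrite big_cons.
by case: (boolP (P i)) => Pi //; apply: L2D => //; exact: FL.
Qed.

Definition sqnorm u : R := \int[mu]_(t in D) (complex.Re `|u t| ^+ 2).

Lemma sqnorm_ge0 u : 0 <= sqnorm u.
Proof. by apply: Rintegral_ge0 => t _; exact: sqr_ge0. Qed.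

(** A substitute for the Cauchy-Schwarz inequality: integrate
    2 a b <= d a^2 + d^-1 b^2. The weight d is left to be chosen in the
    applications. *)
Lemma Re_norm_cintegralM u v (d : R) : L2 D u -> L2 D v -> 0 < d ->
  complex.Re `|cintegral D (fun t => u t * v t)| <= d * sqnorm u + d^-1 * sqnorm v.
Proof.
move=> Lu Lv d0; have [uv1 uv2] := L2_cintegrableM Lu Lv.
have /L2P[_ _ u3] := Lu; have /L2P[_ _ v3] := Lv.
pose h t := d * complex.Re `|u t| ^+ 2 + d^-1 * complex.Re `|v t| ^+ 2.
have dZ : mu.-integrable D (EFin \o (fun t => d * complex.Re `|u t| ^+ 2)).
  exact: (integrableZl mD d u3).
have dVZ : mu.-integrable D (EFin \o (fun t => d^-1 * complex.Re `|v t| ^+ 2)).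
  exact: (integrableZl mD d^-1 v3).
have hi : mu.-integrable D (EFin \o h) by exact: (integrableD mD dZ dVZ).
have hE : \int[mu]_(t in D) h t = d * sqnorm u + d^-1 * sqnorm v.
  by rewrite RintegralD// !RintegralZl.
have hi2 : mu.-integrable D (EFin \o (fun t => 2^-1 * h t)).
  exact: (integrableZl mD _ hi).
have half : \int[mu]_(t in D) (2^-1 * h t) = 2^-1 * (d * sqnorm u + d^-1 * sqnorm v).
  by rewrite RintegralZl// hE.
have bd t : complex.Re `|u t * v t| <= 2^-1 * h t.
  rewrite Re_normM /h.
  move: (complex.Re `|u t|) (complex.Re `|v t|) => a b.
  have dd : d * d^-1 = 1 by rewrite mulfV// gt_eqF.
  have : 0 <= d * (a - d^-1 * b) ^+ 2 by rewrite mulr_ge0 ?sqr_ge0// ltW.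
  have -> : d * (a - d^-1 * b) ^+ 2 =
     d * a ^+ 2 - (d * d^-1) * (2 * (a * b)) + (d * d^-1) * d^-1 * b ^+ 2 by ring.
  by rewrite dd; nra.
(* The real and the imaginary part of the integral each contribute half of the
   bound. *)
rewrite (le_trans (Re_norm_le _))//= [leRHS](splitr _).
have E : (d * sqnorm u + d^-1 * sqnorm v) / 2 = \int[mu]_(t in D) (2^-1 * h t).
  by rewrite half mulrC.
rewrite E lerD//.
- rewrite (le_trans (le_normr_Rintegral mD uv1))// le_Rintegral//.
    exact: integrable_norm.
  by move=> t _; rewrite (le_trans (Re_le_norm _)).
- rewrite (le_trans (le_normr_Rintegral mD uv2))// le_Rintegral//.
    exact: integrable_norm.
  by move=> t _; rewrite (le_trans (Im_le_norm _)).
Qed.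

End ComplexIntegral.

(** * Completeness of L2 *)

Section RieszFischer.
Context d (T : measurableType d) (R : realType).
Variables (mu : {measure set T -> \bar R}) (D : set T) (mD : measurable D).

Lemma fast_subsequence (eps : nat -> R) (del : nat -> R) :
  eps n @[n --> \oo] --> 0 -> (forall k, 0 < del k) ->
  exists phi : nat -> nat, [/\ forall k, (k <= phi k)%N,
    forall k, (phi k <= phi k.+1)%N & forall k, eps (phi k) <= del k].
Proof.
move=> eps0 del0.
have [N NP] : {N : nat -> nat & forall k n, (N k <= n)%N -> eps n <= del k}.
  apply: (@choice _ _ (fun k N => forall n, (N <= n)%N -> eps n <= del k)) => k.
  have /cvgrPdist_le/(_ _ (del0 k))[N _ HN] := eps0.
  exists N => n /HN /=; rewrite sub0r normrN; exact: le_trans (ler_norm _).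
pose phi := fix phi k := if k is k'.+1 then maxn (phi k').+1 (N k) else N 0%N.
exists phi; split.
- elim=> // k IH; apply: (@leq_trans (phi k).+1) => //; exact: leq_maxl.
- by move=> k; apply: (@leq_trans (phi k).+1) => //; exact: leq_maxl.
- case=> [|k]; apply: NP => //=; exact: leq_maxr.
Qed.

Lemma cvgn_geometric_increments (f : nat -> R) (C : R) :
  (forall k, `|f k.+1 - f k| <= C * 2^-1 ^+ k) -> cvgn f.
Proof.
move=> fC; pose u k := f k.+1 - f k.
have C0 : 0 <= C by have := fC 0%N; rewrite expr0 mulr1; exact: le_trans.
have : cvgn (series u).
  have h1 : `|2^-1| < 1 :> R by rewrite ger0_norm// invf_lt1// ltr1n.
  have g0 n : 0 <= geometric C 2^-1 n by rewrite /geometric /= mulr_ge0// exprn_ge0.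
  have ug n : `|u n| <= geometric C 2^-1 n := fC n.
  apply: (@normed_cvg R R^o u).
  exact: (series_le_cvg (fun n => normr_ge0 (u n)) g0 ug (is_cvg_geometric_series h1)).
move=> /cvg_ex[l ul]; apply/cvg_ex; exists (l + f 0%N).
have : series u n + f 0%N @[n --> \oo] --> l + f 0%N by apply: cvgD => //; exact: cvg_cst.
apply: cvg_trans; apply: near_eq_cvg; near=> n.
by rewrite /series /= /u telescope_sumr// subrK.
Unshelve. all: by end_near. Qed.

(** Riesz-Fischer, with functions in place of classes. Along a subsequence whose
    increments have squared norm at most 16^-k, the sum of the squared
    increments weighted by 4^k has finite integral, hence is finite almost
    everywhere; there the increments are bounded by a multiple of 2^-k and the
    subsequence converges. Fatou's lemma passes the bounds to the limit. *)
Lemma square_integrable_complete (f : nat -> T -> R) (eps : nat -> R) :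
  (forall n, measurable_fun D (f n)) ->
  eps n @[n --> \oo] --> 0 ->
  (forall n m, (n <= m)%N ->
    (\int[mu]_(t in D) ((f m t - f n t) ^+ 2)%:E <= (eps n)%:E)%E) ->
  exists2 g : T -> R, measurable_fun D g & forall n,
    (\int[mu]_(t in D) ((g t - f n t) ^+ 2)%:E <= (eps n)%:E)%E.
Proof.
move=> mf eps0 feps.
have del0 k : 0 < 16^-1 ^+ k :> R by rewrite exprn_gt0.
have [phi [phi_ge phi_nd phi_eps]] := fast_subsequence eps0 del0.
pose h k t := 4 ^+ k * (f (phi k.+1) t - f (phi k) t) ^+ 2.
have mh k : measurable_fun D (EFin \o h k).
  apply/measurable_EFinP; apply: measurable_funM => //.
  by apply: measurable_funX; exact: measurable_funB.
have h0 k t : (0 <= (EFin \o h k) t)%E.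
  by rewrite lee_fin mulr_ge0 ?sqr_ge0// exprn_ge0.
have inth k : (\int[mu]_(t in D) (EFin \o h k) t <= (4^-1 ^+ k)%:E)%E.
  have -> : 4^-1 ^+ k = 4 ^+ k * 16^-1 ^+ k :> R.
    by rewrite -exprMn; congr (_ ^+ _); lra.
  have m2 : measurable_fun D (fun t => ((f (phi k.+1) t - f (phi k) t) ^+ 2)%:E).
    by apply/measurable_EFinP; apply: measurable_funX; exact: measurable_funB.
  have p2 t : D t -> (0 <= ((f (phi k.+1) t - f (phi k) t) ^+ 2)%:E)%E.
    by move=> _; rewrite lee_fin sqr_ge0.
  have p4 : (0 <= (4 ^+ k : R)%:E)%E by rewrite lee_fin exprn_ge0.
  have := ge0_integralZl mu mD m2 p2 p4.
  rewrite [X in X = _ -> _](_ : _ = (\int[mu]_(t in D) (EFin \o h k) t)%E)// => ->.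
  rewrite EFinM lee_pmul2l ?lte_fin ?exprn_gt0//.
  by rewrite (le_trans (feps _ _ (phi_nd k)))// lee_fin.
pose H t := (\sum_(0 <= k <oo) (EFin \o h k) t)%E.
have mH : measurable_fun D H.
  apply: ge0_emeasurable_sum => // k t _ _; exact: h0.
have H0 t : (0 <= H t)%E by apply: nneseries_ge0 => k _ _; exact: h0.
have intH : (\int[mu]_(t in D) H t < +oo)%E.
  rewrite integral_nneseries//.
  apply: (@le_lt_trans _ _ (\sum_(0 <= k <oo) (4^-1 ^+ k)%:E)%E).
    apply: lee_nneseries => [k _ _|k _]; last exact: inth.
    by apply: integral_ge0 => t _; exact: h0.
  apply: (@le_lt_trans _ _ 2%:E); last exact: ltry.
  apply: lime_le.
    by apply: is_cvg_nneseries => k _ _; rewrite lee_fin exprn_ge0.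
  apply: nearW => k; rewrite sumEFin lee_fin.
  have h1 : `|4^-1| < 1 :> R by rewrite ger0_norm// invf_lt1// ltr1n.
  have := geometric_le_lim k (@ler01 R) _ h1.
  rewrite invr_gt0 => /(_ (ltr0n _ 4)); rewrite /series /geometric /= => gle.
  under eq_bigr do rewrite -[_ ^+ _]mul1r.
  by rewrite (le_trans gle)// ler_pdivrMr; lra.
have Hae : {ae mu, forall t, D t -> H t \is a fin_num}.
  apply: integrable_ae => //; apply/integrableP; split => //.
  by under eq_integral do rewrite gee0_abs//.
(* The upper limit is measurable and defined everywhere; it is the limit
   wherever the subsequence converges. *)
pose g t := fine (limn_esup (fun k => (f (phi k) t)%:E)).
have mg : measurable_fun D g.
  apply: measurableT_comp; first exact: fine_measurable.
  by apply: measurable_fun_limn_esup => k; apply/measurable_EFinP.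
have gcvg t : D t -> H t \is a fin_num -> f (phi k) t @[k --> \oo] --> g t.
  move=> Dt Hfin.
  have : cvgn (fun k => f (phi k) t).
    apply: (@cvgn_geometric_increments _ (1 + fine (H t))) => k.
    have hk : h k t <= fine (H t).
      rewrite -lee_fin fineK//.
      have := @nneseries_lim_ge R (fun k => (EFin \o h k) t) xpredT 0 k.+1.
      move=> /(_ (fun n _ _ => h0 n t)); apply: le_trans.
      rewrite big_mkord big_ord_recr /= leeDr//.
      by apply: sume_ge0 => i _; exact: h0.
    have F0 : 0 <= fine (H t) by exact: fine_ge0.
    have p2 : 0 < 2 ^+ k :> R by rewrite exprn_gt0.
    rewrite exprVn -ler_pdivrMr ?invr_gt0// invrK.
    have -> : `|f (phi k.+1) t - f (phi k) t| * 2 ^+ k =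
        `|(f (phi k.+1) t - f (phi k) t) * 2 ^+ k|.
      by rewrite normrM (ger0_norm (ltW p2)).
    rewrite -ler_sqr ?nnegrE ?addr_ge0// real_normK ?num_real//.
    rewrite exprMn -exprM mulnC exprM mulrC.
    rewrite (_ : 2 ^+ 2 = 4 :> R); last by lra.
    (* The constant 1 + H turns 4^k |increment|^2 <= H into
       2^k |increment| <= 1 + H, as H <= (1 + H)^2. *)
    rewrite (le_trans hk)//; nra.
  move=> /cvg_ex[l fl]; rewrite /g.
  have /cvg_limn_einf_sup[_ ->] : (f (phi k) t)%:E @[k --> \oo] --> l%:E.
    by apply: cvg_EFin; [exact: nearW|exact: fl].
  exact: fl.
exists g => // n.
have mfn m : measurable_fun D (fun t => ((f m t - f n t) ^+ 2)%:E).
  by apply/measurable_EFinP; apply: measurable_funX; exact: measurable_funB.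
pose F k t := ((f (phi k) t - f n t) ^+ 2)%:E.
apply: (@le_trans _ _ (\int[mu]_(t in D) limn_einf (F ^~ t))%E).
  apply: ae_ge0_le_integral => //.
  - by move=> t _; rewrite lee_fin sqr_ge0.
  - by apply/measurable_EFinP; apply: measurable_funX; exact: measurable_funB.
  - move=> t _; rewrite limn_einf_lim; apply: lime_ge; first exact: is_cvg_einfs.
    apply: nearW => k; apply: le_ereal_inf_tmp => _ [m _ <-].
    by rewrite lee_fin sqr_ge0.
  - rewrite (_ : (fun t => _) = (fun t => - limn_esup (-%E \o (F ^~ t)))%E).
      apply: measurableT_comp => //; apply: measurable_fun_limn_esup => k.
      by apply: measurableT_comp => //; exact: mfn.
    by apply/funext => t; rewrite limn_esupN oppeK.
  - move: Hae; apply: filterS => t Ht Dt.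
    have Fl : F k t @[k --> \oo] --> ((g t - f n t) ^+ 2)%:E.
      apply: cvg_EFin; first exact: nearW.
      rewrite /comp /F /=.
      have gl : f (phi k) t - f n t @[k --> \oo] --> g t - f n t.
        by apply: cvgB; [exact: gcvg Dt (Ht Dt)|exact: cvg_cst].
      rewrite expr2; under eq_fun do rewrite expr2.
      by apply: cvgM; exact: gl.
    by rewrite (cvg_limn_einf_sup Fl).1.
apply: le_trans (fatou _ _ _ _) _ => //.
- by move=> k; exact: mfn.
- by move=> k t _; rewrite lee_fin sqr_ge0.
rewrite limn_einf_lim; apply: lime_le; first exact: is_cvg_einfs.
apply: nearW => k.
(* The bound is available only for phi m >= n; the lower limit is bounded by
   the terms of index maxn k n, and phi m >= m. *)
apply: (@le_trans _ _ (\int[mu]_(t in D) F (maxn k n) t)%E).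
  by apply: ereal_inf_lbound; exists (maxn k n) => //=; exact: leq_maxl.
by apply: feps; rewrite (leq_trans (leq_maxr k n)).
Qed.

End RieszFischer.

Section Moment.
Variable R : realType.
Local Notation mu := (@lebesgue_measure R).
Local Notation RT := (measurableTypeR R).
Variables (D : set RT) (mD : measurable D).
Implicit Types (u v w : R -> R[i]).

Definition pdot u v : R[i] := cintegral D (fun t => u t * Num.conj (v t)).

Lemma sqnormE u : L2 D u ->
  (\int[mu]_(t in D) (complex.Re `|u t| ^+ 2)%:E = (sqnorm D u)%:E)%E.
Proof.
move=> /L2P[_ _ u3]; rewrite /sqnorm /Rintegral fineK//.
exact: (integrable_fin_num mD u3).
Qed.

Lemma pdot_sqnorm u : pdot u u = (sqnorm D u)%:C.
Proof.
rewrite /pdot /cintegral; apply/eqP; rewrite eq_complex; apply/andP; split; apply/eqP.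
  by apply: eq_Rintegral => t _; rewrite -Re_norm_conj.
transitivity (\int[mu]_(t in D) (0 : R)).
  by apply: eq_Rintegral => t _; rewrite -Re_norm_conj.
by rewrite /Rintegral integral0.
Qed.

Lemma pdotC u v : L2 D u -> L2 D v -> pdot u v = Num.conj (pdot v u).
Proof.
move=> Lu Lv; have [_ vu] := L2_cintegrableM mD Lv (L2_conj Lu).
apply/eqP; rewrite eq_complex cReJ cImJ /=; apply/andP; split; apply/eqP.
  by apply: eq_Rintegral => t _; rewrite !cReM !cReJ !cImJ; ring.
rewrite -mulN1r -(RintegralZl _ mD vu).
by apply: eq_Rintegral => t _; rewrite !cImM !cReJ !cImJ; ring.
Qed.

Lemma pdot_suml n (a : nat -> R[i]) (e : nat -> R -> R[i]) v :
  (forall j, L2 D (e j)) -> L2 D v ->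
  pdot (fun t => \sum_(k < n) a k * e k t) v = \sum_(k < n) a k * pdot (e k) v.
Proof.
move=> Le Lv.
have ci k : cintegrable D (fun t => e k t * Num.conj (v t)).
  by apply: L2_cintegrableM => //; exact: L2_conj.
rewrite /pdot (eq_cintegral (g := fun t =>
    \sum_(k < n) a k * (e k t * Num.conj (v t)))).
  rewrite (cintegral_sum mD _ _).2; last by move=> k _; exact: cintegrableZ.
  by apply: eq_bigr => k _; rewrite cintegralZ.
by move=> t _; rewrite mulr_suml; apply: eq_bigr => k _; rewrite mulrA.
Qed.

Lemma pdotBl u v w : L2 D u -> L2 D v -> L2 D w ->
  pdot (fun t => u t - v t) w = pdot u w - pdot v w.
Proof.
move=> Lu Lv Lw.
have uw := L2_cintegrableM mD Lu (L2_conj Lw).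
have vw := L2_cintegrableM mD Lv (L2_conj Lw).
rewrite /pdot (eq_cintegral (g := fun t =>
    u t * Num.conj (w t) + -1 * (v t * Num.conj (w t)))).
  by rewrite cintegralD//; [rewrite cintegralZ// mulN1r|exact: cintegrableZ].
by move=> t _; rewrite mulN1r mulrBl.
Qed.

Lemma L2B u v : L2 D u -> L2 D v -> L2 D (fun t => u t - v t).
Proof.
move=> Lu Lv; have := L2D mD Lu (L2Z mD (-1) Lv).
by under eq_fun do rewrite mulN1r.
Qed.

Lemma pdotBr u v w : L2 D u -> L2 D v -> L2 D w ->
  pdot w (fun t => u t - v t) = pdot w u - pdot w v.
Proof.
move=> Lu Lv Lw; rewrite pdotC//; last exact: L2B.
by rewrite pdotBl// (pdotC Lw Lu) (pdotC Lw Lv); exact: rmorphB.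
Qed.

Lemma pdot_bound u v (d : R) : L2 D u -> L2 D v -> 0 < d ->
  complex.Re `|pdot u v| <= d * sqnorm D u + d^-1 * sqnorm D v.
Proof.
move=> Lu Lv d0; have := Re_norm_cintegralM mD Lu (L2_conj Lv) d0.
rewrite (_ : sqnorm D (fun t => Num.conj (v t)) = sqnorm D v)//.
by apply: eq_Rintegral => t _; rewrite Re_norm_conjE.
Qed.

(** The real and imaginary parts are treated separately, each with the bound
    eps, whence the factor 2. *)
Lemma L2_complete (w : nat -> R -> R[i]) (eps : nat -> R) :
  (forall n, L2 D (w n)) -> eps n @[n --> \oo] --> 0 ->
  (forall n m, (n <= m)%N -> sqnorm D (fun t => w m t - w n t) <= eps n) ->
  exists2 u, L2 D u & forall n, sqnorm D (fun t => u t - w n t) <= 2 * eps n.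
Proof.
move=> Lw eps0 weps.
have mRe n : measurable_fun D ((fun t => complex.Re (w n t)) : RT -> R).
  by have [] := Lw n.
have mIm n : measurable_fun D ((fun t => complex.Im (w n t)) : RT -> R).
  by have [] := Lw n.
have le_part (p : R[i] -> R) : (forall z, p z ^+ 2 <= complex.Re `|z| ^+ 2) ->
    (forall z z', p (z - z') = p z - p z') ->
    (forall n, measurable_fun D ((fun t => p (w n t)) : RT -> R)) ->
    forall n m, (n <= m)%N ->
    (\int[mu]_(t in D) ((p (w m t) - p (w n t)) ^+ 2)%:E <= (eps n)%:E)%E.
  move=> pz pB mp n m nm.
  have Lmn := L2B (Lw m) (Lw n).
  apply: (@le_trans _ _ (sqnorm D (fun t => w m t - w n t))%:E); last first.
    by rewrite lee_fin; exact: weps nm.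
  rewrite -(sqnormE Lmn); apply: ge0_le_integral => //.
  - by move=> t _; rewrite lee_fin sqr_ge0.
  - by apply/measurable_EFinP; apply: measurable_funX; exact: measurable_funB.
  - by have /L2P[_ _ /measurable_int] := Lmn.
  - by move=> t _; rewrite lee_fin -pB.
have hRe : forall n m, (n <= m)%N -> (\int[mu]_(t in D)
    ((complex.Re (w m t) - complex.Re (w n t)) ^+ 2)%:E <= (eps n)%:E)%E.
  apply: le_part mRe => [z|[a b] [c d]//].
  by rewrite Re_norm_sqr lerDl sqr_ge0.
have hIm : forall n m, (n <= m)%N -> (\int[mu]_(t in D)
    ((complex.Im (w m t) - complex.Im (w n t)) ^+ 2)%:E <= (eps n)%:E)%E.
  apply: le_part mIm => [z|[a b] [c d]//].
  by rewrite Re_norm_sqr lerDr sqr_ge0.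
have [gr mgr gre] := square_integrable_complete mD mRe eps0 hRe.
have [gi mgi gie] := square_integrable_complete mD mIm eps0 hIm.
pose u t : R[i] := gr t +i* gi t.
have E n : (\int[mu]_(t in D) (complex.Re `|u t - w n t| ^+ 2)%:E <= (2 * eps n)%:E)%E.
  have -> : (\int[mu]_(t in D) (complex.Re `|u t - w n t| ^+ 2)%:E =
     \int[mu]_(t in D) (((gr t - complex.Re (w n t)) ^+ 2)%:E +
        ((gi t - complex.Im (w n t)) ^+ 2)%:E))%E.
    apply: eq_integral => t _; rewrite Re_norm_sqr -EFinD.
    by rewrite /u; case: (w n t).
  rewrite ge0_integralD//.
  - by rewrite mulr2n mulrDl mul1r EFinD leeD.
  - by move=> t _; rewrite lee_fin sqr_ge0.
  - by apply/measurable_EFinP; apply: measurable_funX; exact: measurable_funB.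
  - by move=> t _; rewrite lee_fin sqr_ge0.
  - by apply/measurable_EFinP; apply: measurable_funX; exact: measurable_funB.
have Lu : L2 D u.
  have L0 : L2 D (fun t => u t - w 0%N t).
    split; last by rewrite (le_lt_trans (E 0%N))// ltry.
    - rewrite (_ : (fun t => _) = (fun t : RT => gr t - complex.Re (w 0%N t))).
        by have := measurable_funB mgr (mRe 0%N).
      by apply/funext => t; rewrite /u; case: (w 0%N t).
    - rewrite (_ : (fun t => _) = (fun t : RT => gi t - complex.Im (w 0%N t))).
        by have := measurable_funB mgi (mIm 0%N).
      by apply/funext => t; rewrite /u; case: (w 0%N t).
  have := L2D mD L0 (Lw 0%N).
  by under eq_fun do rewrite subrK.
exists u => // n; rewrite -lee_fin -sqnormE//; exact: L2B.
Qed.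

End Moment.

(** * The moment problem *)

Lemma cconjM (R : realType) (z w : R[i]) :
  Num.conj (z * w) = Num.conj z * Num.conj w.
Proof. exact: rmorphM. Qed.

Lemma cconj_sum (R : realType) (I : Type) (r : seq I) (P : pred I) (F : I -> R[i]) :
  Num.conj (\sum_(i <- r | P i) F i) = \sum_(i <- r | P i) Num.conj (F i).
Proof. exact: rmorph_sum. Qed.

Section MomentProblem.
Variable R : realType.
Local Notation mu := (@lebesgue_measure R).
Variables (s : R) (e : nat -> R -> R[i]^o).
Local Notation D := (`[0, s]%classic : set (measurableTypeR R)).
Hypothesis Le : forall j, L2 D (e j).

Let mD : measurable D. Proof. exact: measurable_itv. Qed.

(** Let w_n be the combination of e_0, ..., e_(n-1) having the first n
    prescribed moments, that is, the solution of least norm of the first n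
    equations. For n <= m the difference w_m - w_n is orthogonal to
    e_0, ..., e_(n-1), hence to w_n, so |w_m - w_n|^2 = |w_m|^2 - |w_n|^2. If
    a is the vector of coefficients of w_n, then
    l |a|^2 <= |w_n|^2 = sum a_k c_k <= |a| |c|, so |w_n|^2 <= M / l. The
    sequence is therefore Cauchy, and its limit has all the prescribed
    moments. *)
Lemma L2_moment_problem (c : nat -> R[i]) (M : R) :
  strongly_minimal_seq (L2dot s) e ->
  (forall N, \sum_(j < N) complex.Re `|c j| ^+ 2 <= M) ->
  exists2 w, L2 D w & forall j, pdot D (e j) w = c j.
Proof.
move=> sm cM.
have eC i j : L2dot s (e i) (e j) = Num.conj (L2dot s (e j) (e i)).
  exact: (pdotC mD (Le i) (Le j)).
have [l l0 lb] := strongly_minimal_bound eC sm.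
have /choice[a aP] : forall n, exists a : nat -> R[i], forall i, (i < n)%N ->
    \sum_(j < n) Num.conj (a j) * pdot D (e i) (e j) = c i.
  by move=> n; exact: (gram_solve eC sm n c).
pose w n t := \sum_(k < n) a n k * e k t.
have Lw n : L2 D (w n) by apply: L2_sum => // k _; exact: L2Z.
have ew n i : (i < n)%N -> pdot D (e i) (w n) = c i.
  move=> iltn; rewrite (pdotC mD)// pdot_suml// -(aP n i iltn) cconj_sum.
  by apply: eq_bigr => j _; rewrite cconjM -(pdotC mD).
pose S n := sqnorm D (w n).
have wS n m : (n <= m)%N -> pdot D (w n) (w m) = \sum_(k < n) a n k * c k.
  move=> nm; rewrite pdot_suml//; apply: eq_bigr => k _.
  by rewrite ew// (leq_trans _ nm).
have wnm n m : (n <= m)%N -> pdot D (w n) (w m) = (S n)%:C.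
  by move=> nm; rewrite wS// -(wS n n)// pdot_sqnorm.
have dS n m : (n <= m)%N -> sqnorm D (fun t => w m t - w n t) = S m - S n.
  move=> nm; apply: (@complexI R); rewrite -pdot_sqnorm.
  have Lmn := L2B mD (Lw m) (Lw n).
  rewrite pdotBl// !pdotBr// (pdotC mD (Lw m) (Lw n)) !wnm// conj_realc.
  by rewrite subrr subr0 realcB.
have SG n : S n = gram_form (L2dot s) e n (a n).
  rewrite /gram_form; have := pdot_sqnorm D (w n); rewrite pdot_suml// => E.
  have -> : S n = complex.Re (S n)%:C by [].
  rewrite -E; congr complex.Re; apply: eq_bigr => i _.
  rewrite (pdotC mD)// pdot_suml// cconj_sum mulr_sumr; apply: eq_bigr => j _.
  by rewrite cconjM mulrA -(pdotC mD).
have S0 n : 0 <= S n by exact: sqnorm_ge0.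
have Sub n : S n <= M / l.
  have lbn : l * \sum_(i < n) complex.Re `|a n i| ^+ 2 <= S n by rewrite SG; exact: lb.
  have Sle : S n <= \sum_(k < n) complex.Re `|a n k| * complex.Re `|c k|.
    have -> : S n = complex.Re (\sum_(k < n) a n k * c k).
      by rewrite -(wS n n)// pdot_sqnorm.
    rewrite (le_trans (ler_norm _))// (le_trans (Re_le_norm _))//.
    elim/big_ind2: _ => [|x1 x2 y1 y2 h1 h2|k _]; first by rewrite normr0.
      by rewrite (le_trans (Re_normD _ _))// lerD.
    by rewrite Re_normM.
  have amgm : \sum_(k < n) complex.Re `|a n k| * complex.Re `|c k| <=
      2^-1 * (l * \sum_(i < n) complex.Re `|a n i| ^+ 2 +
              l^-1 * \sum_(i < n) complex.Re `|c i| ^+ 2).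
    rewrite !mulr_sumr -big_split mulr_sumr; apply: ler_sum => k _.
    move: (complex.Re `|a n k|) (complex.Re `|c k|) => x y /=.
    have ll : l * l^-1 = 1 by rewrite mulfV// gt_eqF.
    have : 0 <= l * (x - l^-1 * y) ^+ 2 by rewrite mulr_ge0 ?sqr_ge0// ltW.
    have -> : l * (x - l^-1 * y) ^+ 2 =
       l * x ^+ 2 - (l * l^-1) * (2 * (x * y)) + (l * l^-1) * l^-1 * y ^+ 2 by ring.
    by rewrite ll; nra.
  have cl : l^-1 * \sum_(i < n) complex.Re `|c i| ^+ 2 <= M / l.
    by rewrite mulrC ler_wpM2r// invr_ge0 ltW.
  by lra.
have Snd : nondecreasing_seq S.
  by move=> n m nm; rewrite -subr_ge0 -dS//; exact: sqnorm_ge0.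
have Scv : S n @[n --> \oo] --> sup (range S).
  apply: nondecreasing_cvgn => //.
  by exists (M / l) => _ [n _ <-]; exact: Sub.
pose eps n := sup (range S) - S n.
have eps0 : eps n @[n --> \oo] --> 0.
  rewrite -[X in _ --> X](subrr (sup (range S))).
  by apply: cvgB => //; exact: cvg_cst.
have Slim n : S n <= sup (range S).
  by apply: ub_le_sup; [exists (M / l) => _ [k _ <-]; exact: Sub|exists n].
have [|u Lu ue] := L2_complete mD Lw eps0.
  by move=> n m nm; rewrite dS// lerB.
exists u => // j; apply/eqP; rewrite -subr_eq0; apply/eqP/Re_norm_eq0/eqP.
rewrite eq_le Re_norm_ge0 andbT; apply/ler_addgt0Pr => r r0; rewrite add0r.
(* With this d both terms of the bound of pdot_bound are at most r / 2 as soon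
   as |u - w_n|^2 <= 2 eps n < r d / 2. *)
pose d := r / 2 / (sqnorm D (e j) + 1).
have q0 : 0 < sqnorm D (e j) + 1 by rewrite ltr_wpDl// sqnorm_ge0.
have d0 : 0 < d by rewrite !divr_gt0.
have p0 : 0 < r * d / 4 by rewrite divr_gt0// mulr_gt0.
have /cvgrPdist_lt/(_ _ p0) near1 := eps0.
have near2 : \forall n \near \oo, (j < n)%N by exists j.+1.
have [n [n1 n2]] := filter_ex (filterI near1 near2).
have en : eps n < r * d / 4.
  by move: n1; rewrite sub0r normrN ger0_norm// /eps subr_ge0.
rewrite -(ew n j n2) -pdotBr//.
have := pdot_bound mD (Le j) (L2B mD Lu (Lw n)) d0; move/le_trans; apply.
rewrite [leRHS](splitr r) lerD//.
  rewrite /d mulrAC ler_pdivrMr// ler_wpM2l//; first by rewrite divr_ge0// ltW.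
  by rewrite lerDl.
rewrite ler_pdivrMl// (le_trans (ue n))//; lra.
Qed.

End MomentProblem.

(** * Exponentials and truncation *)

Section Exponentials.
Variable R : realType.
Local Notation mu := (@lebesgue_measure R).
Local Notation RT := (measurableTypeR R).

Lemma itv_finite_measure (a b : R) : (mu `[a, b] < +oo)%E.
Proof. by rewrite lebesgue_measure_itv; case: ifP => _; rewrite -?EFinB ltry. Qed.

Lemma L2_exponential (z c : R[i]) (s : R) :
  L2 `[0, s] (fun t : R => cexp (z * t%:C) * c).
Proof.
have ce t := @cexp_continuous_real R z t.
have cR : continuous (fun t : R => complex.Re (cexp (z * t%:C))).
  move=> t; apply/cvgrPdist_lt => e e0; have /cvg_rnormP/(_ e e0) := ce t.
  apply: filterS => u; apply: le_lt_trans.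
  apply: le_trans (Re_le_norm _); rewrite le_eqVlt; apply/orP; left; apply/eqP.
  by case: (cexp (z * t%:C)) => ? ?; case: (cexp (z * u%:C)).
have cI : continuous (fun t : R => complex.Im (cexp (z * t%:C))).
  move=> t; apply/cvgrPdist_lt => e e0; have /cvg_rnormP/(_ e e0) := ce t.
  apply: filterS => u; apply: le_lt_trans.
  apply: le_trans (Im_le_norm _); rewrite le_eqVlt; apply/orP; left; apply/eqP.
  by case: (cexp (z * t%:C)) => ? ?; case: (cexp (z * u%:C)).
have mD : @measurable _ RT `[0, s] by exact: measurable_itv.
have mR : measurable_fun `[0, s] ((fun t => complex.Re (cexp (z * t%:C))) : RT -> R).
  by apply: measurable_funS (continuous_measurable_fun cR).
have mI : measurable_fun `[0, s] ((fun t => complex.Im (cexp (z * t%:C))) : RT -> R).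
  by apply: measurable_funS (continuous_measurable_fun cI).
have Lc : L2 `[0, s] (fun t : R => cexp (z * t%:C)).
  apply/L2P; split => //.
  apply: (bounded_integrable (M := expR (`|complex.Re z| * s) ^+ 2)) => //.
  - exact: itv_finite_measure.
  - rewrite (_ : (fun t => _) = (fun t : RT => complex.Re (cexp (z * t%:C)) ^+ 2 +
        complex.Im (cexp (z * t%:C)) ^+ 2)); last first.
      by apply/funext => t; exact: Re_norm_sqr.
    by apply: measurable_funD; exact: measurable_funX.
  - move=> t /=; rewrite in_itv /= => /andP[t0 ts].
    rewrite ger0_norm ?sqr_ge0//.
    suff : complex.Re `|cexp (z * t%:C)| <= expR (`|complex.Re z| * s).
      by move=> H; rewrite ler_sqr// nnegrE ?Re_norm_ge0// expR_ge0.
    rewrite Re_norm_cexp ler_expR cReM /= mulr0 subr0.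
    by rewrite (le_trans (ler_norm _))// normrM (ger0_norm t0) ler_wpM2l.
have := L2Z mD c Lc.
rewrite (_ : (fun t => c * _) = (fun t : R => cexp (z * t%:C) * c))//.
by apply/funext => t; rewrite mulrC.
Qed.

Lemma L2_restrict (D D' : set RT) (u : R -> R[i]) :
  measurable D -> measurable D' -> L2 D u ->
  L2 D' (fun t : R => if t \in D then u t else 0).
Proof.
move=> mD mD' /L2P[u1 u2 u3].
have E (p : R[i] -> R) : p 0 = 0 ->
    (fun t : R => p (if t \in D then u t else 0)) = (fun t => p (u t)) \_ D.
  by move=> p0; apply/funext => t; rewrite /patch; case: ifP.
have mp (p : R[i] -> R) : p 0 = 0 -> measurable_fun D ((fun t => p (u t)) : RT -> R) ->
    measurable_fun D' ((fun t => p (if t \in D then u t else 0)) : RT -> R).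
  move=> p0 mpu; rewrite E//; apply/(measurable_restrict _ mD mD').
  by apply: measurable_funS mpu => //; exact: subIsetr.
apply/L2P; split; [exact: mp u1|exact: mp u2|].
have n0 : complex.Re `|0 : R[i]| ^+ 2 = 0 :> R by rewrite normr0 expr0n.
have -> : (fun t : R => complex.Re `|if t \in D then u t else 0| ^+ 2) =
    (fun t => complex.Re `|u t| ^+ 2) \_ D.
  exact: (E (fun z => complex.Re `|z| ^+ 2)).
rewrite (_ : EFin \o _ = (EFin \o (fun t => complex.Re `|u t| ^+ 2)) \_ D); last first.
  by apply/funext => t; rewrite /patch /=; case: ifP.
apply/(integrable_restrict _ mD mD').
by apply: integrableS u3 => //; exact: measurableI.
Qed.

Lemma cintegral_restrict (D D' : set RT) (f : R -> R[i]) : D `<=` D' ->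
  cintegral D' (fun t : R => if t \in D then f t else 0) = cintegral D f.
Proof.
move=> DD'.
have E (p : R[i] -> R) : p 0 = 0 ->
    \int[mu]_(t in D') p (if t \in D then f t else 0) = \int[mu]_(t in D) p (f t).
  move=> p0; rewrite [RHS](_ : _ = \int[mu]_(t in D' `&` D) p (f t)); last first.
    by congr Rintegral; apply/seteqP; split=> t; [move=> Dt; split=> //; exact: DD'|case].
  rewrite Rintegral_mkcondr; apply: eq_Rintegral => t _.
  by rewrite /patch; case: ifP.
by rewrite /cintegral !E.
Qed.

End Exponentials.

(** * Moments of controls *)

Section ControlMoments.
Variables (R : realType) (X V : completeNormedModType R[i]).
Variables (dot : {dot X for Num.conj}) (iota : {linear X -> V}).
Hypothesis hdot : inner_product_norm dot.
Variable duality : V -> X -> R[i].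
Variables (S : R -> {linear X -> X}) (SV : R -> {linear V -> V}).
Hypothesis hS : C0_semigroup S.
Hypothesis hdual : antidual_of_domain dot iota duality (adjoint dot (generator S)).
Hypothesis hSV : semigroup_extension iota S SV.
Hypothesis hdense : dense (range iota).
Variables (z mu0 : R[i]) (psi : X) (b : V).
Hypothesis adj : adjoint dot (generator S) (psi, Num.conj z *: psi).
Hypothesis res : resolvent_set (generator S) mu0.
Local Notation mu := (@lebesgue_measure R).
Local Notation RT := (measurableTypeR R).

(** Pairing with psi is a bounded functional on V and passes under the Bochner
    integral, where it turns S(t - tau) into multiplication by
    exp(z (t - tau)). The function u' allows a control that vanishes almost
    everywhere after some time to be replaced by its truncation. *)
Lemma duality_input_term (t : R) (u u' : R -> R[i]) (v : V) : 0 <= t ->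
  input_term SV b t u v -> L2 `[0, t] u' ->
  {ae mu, forall tau, 0 <= tau <= t -> u tau = u' tau} ->
  duality v psi = cexp (z * t%:C) *
    cintegral `[0, t] (fun tau : R => u' tau * (cexp (- z * tau%:C) * duality b psi)).
Proof.
move=> t0 ut Lu' uu'.
have psidom : op_dom (adjoint dot (generator S)) psi by exists (Num.conj z *: psi).
have mD : @measurable _ RT `[0, t] by exact: measurable_itv.
have Dfin := itv_finite_measure 0 t.
have [K K0 dK] := duality_bounded hdual psidom.
pose g (tau : R) := cexp (z * t%:C) *
  (u' tau * (cexp (- z * tau%:C) * duality b psi)).
have ci := L2_cintegrableM mD Lu' (L2_exponential (- z) (duality b psi) t).
have [gR gI] : cintegrable `[0, t] g by exact: cintegrableZ.
rewrite -cintegralZ// -/g.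
have fg : {ae mu, forall tau, `[0, t]%classic tau ->
    duality (u tau *: SV (t - tau) b) psi = g tau}.
  move: uu'; apply: ae_lebesgueS => tau ue /=; rewrite in_itv/= => taut.
  rewrite (dualityZl hdual)// (duality_semigroup hdot hS hdual hSV hdense adj res).
    rewrite ue// /g realcB mulrBr cexpD -mulNr.
    by move: (cexp _) (cexp _) (duality b psi) (u' tau) => p q d w; ring.
  by rewrite subr_ge0; case/andP: taut.
have lRe : real_linear (fun v : V => complex.Re (duality v psi)).
  split=> [v1 v2|a v1]; first by rewrite (dualityDl hdual)// cReD.
  by rewrite (dualityZl hdual)// cReM /= mul0r subr0.
have lIm : real_linear (fun v : V => complex.Im (duality v psi)).
  split=> [v1 v2|a v1]; first by rewrite (dualityDl hdual)// cImD.
  by rewrite (dualityZl hdual)// cImM /= mul0r addr0.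
have bRe v1 : `|complex.Re (duality v1 psi)| <= K * rnorm v1.
  exact: le_trans (Re_le_norm _) (dK _).
have bIm v1 : `|complex.Im (duality v1 psi)| <= K * rnorm v1.
  exact: le_trans (Im_le_norm _) (dK _).
apply/eqP; rewrite eq_complex; apply/andP; split; apply/eqP.
- apply: (Bochner_real_linear mD Dfin lRe bRe ut _ gR).
  by move: fg; apply: ae_lebesgueS => tau H /H ->.
- apply: (Bochner_real_linear mD Dfin lIm bIm ut _ gI).
  by move: fg; apply: ae_lebesgueS => tau H /H ->.
Qed.

End ControlMoments.

(** * Expansions in eigenvectors *)

Section Expansion.
Variables (R : realType) (X : completeNormedModType R[i]).
Variable dot : {dot X for Num.conj}.
Hypothesis hdot : inner_product_norm dot.
Variables (S : R -> {linear X -> X}) (phi psi : nat -> X) (T : R).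
Hypothesis biorth : forall k j : nat, dot (phi k) (psi j) = (k == j)%:R.
Hypothesis hT : eigenvector_expansion S phi T.

Lemma dot_biorth_sum n (c : nat -> R[i]) k : (k < n)%N ->
  dot (\sum_(j < n) c j *: phi j) (psi k) = c k.
Proof.
move=> kn; rewrite linear_sumlz (bigD1 (Ordinal kn))//= big1 ?addr0.
  by rewrite linearZl_LR /= biorth eqxx mulr1.
move=> i ik; have /negbTE ink : (i : nat) != k by move: ik; rewrite -val_eqE.
by rewrite linearZl_LR /= biorth ink mulr0.
Qed.

(** Pairing the partial sums with psi_k identifies the coefficients of the
    expansion. *)
Lemma biorthogonal_expansion (x : X) (t : R) : T < t ->
  \sum_(j < n) dot (S t x) (psi j) *: phi j @[n --> \oo] --> S t x.
Proof.
move=> Tt; have [c cx] := hT x.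
have T1 : T < (T + t) / 2 by lra.
have T2 : (T + t) / 2 < t + 1 by lra.
have ptw : \sum_(j < n) c j t *: phi j @[n --> \oo] --> S t x.
  have tin : [set t] `<=` `[(T + t) / 2, t + 1].
    by move=> _ ->; rewrite /= in_itv /=; apply/andP; split; lra.
  have := uniform_subset_cvg _ tin (cx _ _ T1 T2).
  by rewrite uniform_set1 => H; exact: H.
have cE k : c k t = dot (S t x) (psi k).
  have lim1 : (dot (\sum_(j < n) c j t *: phi j) (psi k) : R[i]^o) @[n --> \oo]
      --> (dot (S t x) (psi k) : R[i]^o) by exact: cvg_dotl.
  have lim2 : (dot (\sum_(j < n) c j t *: phi j) (psi k) : R[i]^o) @[n --> \oo]
      --> (c k t : R[i]^o).
    have lim3 : (fun=> c k t : R[i]^o) n @[n --> \oo] --> (c k t : R[i]^o).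
      exact: cvg_cst.
    apply: cvg_trans lim3; apply: near_eq_cvg; exists k.+1 => // n /= kn.
    by rewrite (dot_biorth_sum (fun j => c j t)).
  exact: (cvg_unique _ lim2 lim1).
by under eq_fun do under eq_bigr do rewrite -cE.
Qed.

(** The Gram form of the coefficients is the squared norm of a partial sum of
    the expansion of S(t) x, and the partial sums are bounded. *)
Lemma square_summable_coefficients (x : X) (t : R) :
  strongly_minimal_seq dot phi -> T < t ->
  exists B : R, forall N,
    \sum_(j < N) complex.Re `|dot (S t x) (psi j)| ^+ 2 <= B.
Proof.
move=> sm Tt.
have phiC i j : dot (phi i) (phi j) = Num.conj (dot (phi j) (phi i)) by exact: dotC.
have [l l0 lb] := strongly_minimal_bound phiC sm.
exists ((rnorm (S t x) + 1) ^+ 2 / l) => N.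
pose d j := dot (S t x) (psi j).
have /cvg_rnormP/(_ _ ltr01) near1 := @biorthogonal_expansion x t Tt.
have near2 : \forall n \near \oo, (N <= n)%N by exists N.
have [n [n1 n2]] := filter_ex (filterI near1 near2).
have gramE : gram_form dot phi n d = rnorm (\sum_(j < n) d j *: phi j) ^+ 2.
  have -> : rnorm (\sum_(j < n) d j *: phi j) ^+ 2 =
      complex.Re (dot (\sum_(j < n) d j *: phi j) (\sum_(j < n) d j *: phi j)).
    by rewrite (dotrnorm hdot).
  congr complex.Re; symmetry; rewrite linear_sumlz; apply: eq_bigr => i _.
  rewrite linearZl_LR linear_sumr mulr_sumr; apply: eq_bigr => j _.
  by rewrite linearZr_LR /= mulrA.
apply: (@le_trans _ _ (\sum_(j < n) complex.Re `|d j| ^+ 2)).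
  rewrite (big_ord_widen _ (fun j => complex.Re `|d j| ^+ 2) n2) big_mkcond.
  by apply: ler_sum => j _; case: ifP => // _; exact: sqr_ge0.
rewrite ler_pdivlMr// mulrC (le_trans (lb n d))// gramE.
rewrite ler_sqr ?nnegrE ?addr_ge0 ?rnorm_ge0//.
have := ler_rnormD (S t x) (\sum_(j < n) d j *: phi j - S t x).
rewrite addrC subrK => /le_trans; apply.
by rewrite lerD2l rnorm_distC ltW.
Qed.

End Expansion.

(** * Null-controllability and the exponential family *)

Theorem theorem2 (R : realType) (X V : completeNormedModType R[i])
  (dotX : {dot X for Num.conj}) (dotV : {dot V for Num.conj})
  (hX : inner_product_norm dotX) (hV : inner_product_norm dotV)
  (sepX : separable_space X)
  (S : R -> {linear X -> X}) (hS : C0_semigroup S)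
  (A : set (X * X)) (hA : A = generator S)
  (iota : {linear X -> V}) (duality : V -> X -> R[i])
  (hdual : antidual_of_domain dotX iota duality (adjoint dotX A))
  (hdense : dense_injections iota (adjoint dotX A))
  (SV : R -> {linear V -> V}) (hSV : semigroup_extension iota S SV)
  (b : V) (hb : admissible_input iota SV b)
  (hspec : simple_discrete_spectrum A)
  (lam : nat -> R[i]) (phi psi : nat -> X)
  (lam_inj : injective lam) (lam_enum : range lam = spectrum A)
  (lam_mono : forall j k : nat, (j <= k)%N -> `|lam j| <= `|lam k|)
  (hphi : forall j, A (phi j, lam j *: phi j))
  (hpsi : forall j, adjoint dotX A (psi j, Num.conj (lam j) *: psi j))
  (biorth : forall k j : nat, dotX (phi k) (psi j) = (k == j)%:R)
  (T : R) (T_ge0 : 0 <= T) (hT : eigenvector_expansion S phi T)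
  (t1 : R) (ht1 : T < t1)
  (phi_strong : strongly_minimal_seq dotX phi) :
  let e := fun (j : nat) (t : R) =>
    (cexp (- lam j * t%:C) * duality b (psi j) : R[i]^o) in
  (exact_null_controllable iota S SV b t1 (t1 - T) ->
     minimal_seq (L2dot (t1 - T)) e) /\
  ((exists beta : R, forall j, beta <= complex.Re (lam j)) ->
     strongly_minimal_seq (L2dot (t1 - T)) e ->
     exact_null_controllable iota S SV b t1 (t1 - T)).
Proof.
set e := (e in let _ := e in _); move=> e'.
have lp0 : limit_point (spectrum A : set R[i]^o) = set0 by case: hspec.
have [mu0 res] := resolvent_set_nonempty lp0.
subst A.
have [_ iota_inj _ iota_dense] := hdense.
have s0 : 0 <= t1 - T by rewrite subr_ge0 ltW.
have t10 : 0 <= t1 by rewrite (le_trans T_ge0)// ltW.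
have st1 : t1 - T <= t1 by rewrite gerBl.
pose Ds : set (measurableTypeR R) := `[0, t1 - T]%classic.
pose D1 : set (measurableTypeR R) := `[0, t1]%classic.
have mDs : measurable Ds by exact: measurable_itv.
have mD1 : measurable D1 by exact: measurable_itv.
have DsD1 : Ds `<=` D1.
  move=> t; rewrite /Ds /D1 /= !in_itv /= => /andP[-> /le_trans]; exact.
have psidom j : op_dom (adjoint dotX (generator S)) (psi j).
  by exists (Num.conj (lam j) *: psi j).
have Le j : L2 Ds (e j) by exact: L2_exponential.
have dotS x j t : 0 <= t -> dotX (S t x) (psi j) = cexp (lam j * t%:C) * dotX x (psi j).
  exact: (dot_semigroup hX hS (hpsi j) res).
have moments j t u u' v : 0 <= t -> input_term SV b t u v -> L2 `[0, t] u' ->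
    {ae @lebesgue_measure R, forall tau, 0 <= tau <= t -> u tau = u' tau} ->
    duality v (psi j) = cexp (lam j * t%:C) *
      cintegral `[0, t] (fun tau : R => u' tau * e j tau).
  exact: (duality_input_term hX hS hdual hSV iota_dense (hpsi j) res).
split.
- move=> ENC j clos.
  (* The control steering phi_j to 0 is, up to sign, biorthogonal to the e_k. *)
  have [u [Lu u0 [v uv v0]]] := ENC (phi j).
  have uk k : cintegral Ds (fun t : R => u t * e k t) = - (j == k)%:R.
    have := @moments k t1 u (fun t => if t \in Ds then u t else 0) v t10 uv.
    have L1 := L2_restrict mDs mD1 Lu.
    move=> /(_ L1); have ae_eq : {ae @lebesgue_measure R,
        forall tau, 0 <= tau <= t1 -> u tau = if tau \in Ds then u tau else 0}.
      move: u0; apply: ae_lebesgueS => t tu /andP[t0 tt1].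
      case: ifPn => //; rewrite notin_setE /Ds /= in_itv /= t0 /= => tDs.
      by apply: tu; rewrite leNgt; apply/negP => /ltW.
    move=> /(_ ae_eq).
    rewrite (eq_cintegral (g := fun tau : R => if tau \in Ds then u tau * e k tau else 0));
      last by move=> t _; case: ifP => // _; rewrite mul0r.
    rewrite (cintegral_restrict _ DsD1).
    have := congr1 (fun w => duality w (psi k)) v0.
    rewrite linear0 (duality0l hdual (psidom k)) (dualityDl hdual)//.
    rewrite (duality_iota hdual)// dotS// biorth => /esym v0k vk.
    have : cexp (lam k * t1%:C) *
        ((j == k)%:R + cintegral Ds (fun t : R => u t * e k t)) = 0.
      by rewrite mulrDr -vk.
    move=> /(congr1 (fun w => cexp (- (lam k * t1%:C)) * w)).
    rewrite mulrA cexpNK mul1r mulr0 => /eqP; rewrite addrC addr_eq0.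
    by move/eqP.
  pose N := sqnorm Ds u.
  have N1 : 0 < N + 1 by rewrite ltr_wpDl// sqnorm_ge0.
  (* With u as above and r = e_j - y, |r|^2 < d / 4, the bound
     1 = |int u r| <= d |u|^2 + d^-1 |r|^2 < 1/4 + 1/4 is contradictory. *)
  pose d := (4 * (N + 1))^-1.
  have d0 : 0 < d by rewrite invr_gt0 mulr_gt0.
  have eps0 : 0 < Num.sqrt (d / 4) by rewrite sqrtr_gt0 divr_gt0.
  have [y [n [c yE]]] := clos _ eps0.
  pose r (t : R) : R[i] := e j t - y t.
  have yt (t : R) : y t = \sum_(k < n | (k : nat) != j) c k * e k t.
    by rewrite yE fct_sumE.
  have Lr : L2 Ds r.
    have Ly : L2 Ds (fun t : R => \sum_(k < n | (k : nat) != j) c k * e k t).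
      by apply: L2_sum => // k _; exact: L2Z.
    have := L2B mDs (Le j) Ly.
    rewrite (_ : (fun t : R => e j t - _) = r)//.
    by apply/funext => t; rewrite /r yt.
  rewrite -[L2dot _ _ _]/(pdot Ds r r) pdot_sqnorm /=.
  rewrite ltr_sqrt ?divr_gt0// => rsmall.
  have ue k : cintegrable Ds (fun t => u t * e k t) by exact: L2_cintegrableM.
  have ur : cintegral Ds (fun t => u t * r t) = -1.
    rewrite (eq_cintegral (g := fun t => u t * e j t +
        \sum_(k < n | (k : nat) != j) (- c k) * (u t * e k t))); last first.
      move=> t _; rewrite /r yt mulrBr mulr_sumr -sumrN; congr (_ + _).
      by apply: eq_bigr => k _; rewrite mulNr mulrCA.
    have sum_int : forall k : 'I_n, (k : nat) != j ->
        cintegrable Ds (fun t => - c k * (u t * e k t)).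
      by move=> k _; exact: cintegrableZ.
    have [csum csumE] := cintegral_sum mDs (index_enum 'I_n) sum_int.
    rewrite cintegralD// csumE uk eqxx big1 ?addr0// => k kj.
    by rewrite cintegralZ// uk eq_sym (negbTE kj) oppr0 mulr0.
  have := Re_norm_cintegralM mDs Lu Lr d0.
  rewrite ur normrN normr1 -/N => H.
  have dN : d * N <= 4^-1.
    rewrite /d invfM -mulrA ler_piMr ?invr_ge0//.
    by rewrite mulrC ler_pdivrMr// mul1r lerDl.
  have dr : d^-1 * sqnorm Ds r < 4^-1.
    by rewrite ltr_pdivrMl// mulrC [4^-1 * _]mulrC.
  rewrite /= in H; move: (le_lt_trans H (ler_ltD dN dr)); clear; lra.
- move=> [beta lam_beta] e_strong x0.
  (* Any time beyond T serves to obtain the square summability. *)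
  have T1 : T < T + 1 by rewrite ltrDl.
  have [B HB] := square_summable_coefficients hX biorth hT x0 phi_strong T1.
  pose c j := - dotX x0 (psi j).
  pose q := expR (beta * (T + 1)).
  have q0 : 0 < q by exact: expR_gt0.
  have T10 : 0 <= T + 1 by rewrite addr_ge0.
  have cB N : \sum_(j < N) complex.Re `|c j| ^+ 2 <= B / q ^+ 2.
    rewrite ler_pdivlMr ?exprn_gt0// (le_trans _ (HB N))// mulr_suml.
    apply: ler_sum => j _; rewrite dotS// Re_normM exprMn mulrC Re_normN.
    rewrite ler_wpM2r ?sqr_ge0// ler_sqr ?nnegrE ?Re_norm_ge0 ?(ltW q0)//.
    by rewrite Re_norm_cexp cReM /= mulr0 subr0 /q ler_expR ler_wpM2r.
  have [w Lw we] := L2_moment_problem (s := t1 - T) Le e_strong cB.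
  (* The inner product is conjugate linear in w, the moments are linear in the
     control. *)
  pose u (t : R) : R[i] := if t \in Ds then Num.conj (w t) else 0.
  have Lwc := L2_conj Lw.
  have Lu D (mD : @measurable _ (measurableTypeR R) D) : L2 D u.
    exact: L2_restrict mDs mD Lwc.
  have Luloc : L2loc u by move=> t t0; apply: Lu; exact: measurable_itv.
  have [x uz] := hb u Luloc _ s0.
  have ue j : cintegral Ds (fun t => u t * e j t) = c j.
    rewrite -we /pdot; apply: eq_cintegral => t Dt.
    by rewrite /u mem_set// mulrC.
  have zpsi j : dotX x (psi j) = cexp (lam j * (t1 - T)%:C) * c j.
    rewrite -(duality_iota hdual)// (moments j (t1 - T) u u _ s0 uz (Lu _ mDs)).
      by rewrite -ue.
    exact: aeW.
  (* The state at time t1 - T. *)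
  pose y := S (t1 - T) x0 + x.
  have ypsi j : dotX y (psi j) = 0.
    have -> : dotX y (psi j) = dotX (S (t1 - T) x0) (psi j) + dotX x (psi j).
      by rewrite /y linearDl.
    by rewrite dotS// zpsi /c mulrN addrN.
  have Sy t : T < t -> S t y = 0.
    move=> Tt; have := @biorthogonal_expansion _ _ _ hX S phi psi T biorth hT y t Tt.
    under eq_fun do under eq_bigr do
      rewrite dotS ?(le_trans T_ge0 (ltW Tt))// ypsi mulr0 scale0r.
    under eq_fun do rewrite big1//.
    by move=> H; apply: (cvg_unique _ H (cvg_cst _)) => //; exact: norm_hausdorff.
  have STy : S T y = 0.
    have H := @orbit_right_continuous _ _ S hS T y T_ge0.
    have H0 : (fun=> 0 : X) h @[h --> (0 : R)^'+] --> (0 : X) by exact: cvg_cst.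
    have H1 : S (T + h) y @[h --> 0^'+] --> (0 : X).
      apply: cvg_trans H0; apply: near_eq_cvg; near=> h.
      by rewrite Sy// ltrDl.
    exact: (cvg_unique _ H H1).
  exists u; split.
  - exact: Lu.
  - exists [set t1 - T]; split.
    + exact: measurable_set1.
    + exact: lebesgue_measure_set1.
    + move=> t /= /not_implyP[tt ut]; apply/eqP; rewrite eq_le tt andbT leNgt.
      apply/negP => tlt; apply: ut; rewrite /u memNset//.
      by rewrite /Ds /= in_itv /= => /andP[_]; rewrite leNgt tlt.
  - (* The input term at time t1 is the image by S(T) of the one at t1 - T, as
       u vanishes in between. *)
    have [[SVc _ SVD _] SVi _ _] := hSV.
    exists (SV T (iota x)).
      apply: (Bochner_linear hV (L := SV T) (D := Ds)
        (f := fun tau => u tau *: SV (t1 - T - tau) b)) => //.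
      + exact: SVc.
      + exact: itv_finite_measure.
      + move=> t; rewrite /Ds /= in_itv /= => /andP[t0 ts].
        rewrite linearZ /= -SVD ?subr_ge0//.
        by congr (_ *: SV _ _); ring.
      + by move=> t _ tDs; rewrite /u memNset// scale0r.
    have [_ _ SD _] := hS.
    have -> : S t1 x0 = S T (S (t1 - T) x0).
      by rewrite -SD//; congr (S _ _); rewrite addrC subrK.
    by rewrite SVi// -linearD -linearD STy.
Unshelve. all: by end_near. Qed.
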